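(* Let $S$ be a finite semigroup with an anti-involution $*$, let $R$ be a field, and let $\alpha$ be a twisting from $S$ into $R$ with $\alpha(x,y)=\alpha(y^*,x^* )$ for all $x,y\in S$. Suppose that for each $\mathcal D$-class $D$ there is an idempotent $1_D\in D$ with $1_D^*=1_D$; let $G_D$ be the $\mathcal H$-class of $1_D$. Suppose that $\alpha(x,y)\neq0$ whenever $x\,\mathcal L\,1_D$ and $y\,\mathcal R\,1_D$ for some $\mathcal D$-class $D$. Suppose that for each $D$ the twisted group algebra $R^\alpha[G_D]$ is cellular with cell datum $(\Lambda_D,M_D,C,* )$, where $*$ is the linear extension of $*|_{G_D}$. For each $\mathcal L$-class $L$ in $D$ choose $u_L\in L$ with $u_L\,\mathcal R\,1_D$, and let $P_D^\alpha$ be the matrix indexed by pairs of $\mathcal L$-classes in $D$ with entries in $R^\alpha[G_D]$ given by $(P_D^\alpha)_{LK}=0$ if $u_Lu_K^*<_{\mathcal D}D$, and $(P_D^\alpha)_{LK}=\alpha(u_L,u_K^* )\,u_Lu_K^*$ if $u_Lu_K^*\in G_D$. Then $R^\alpha[S]$ is semisimple if and only if, for every $\mathcal D$-class $D$, (i) $R^\alpha[G_D]$ is semisimple and (ii) $P_D^\alpha$ is invertible (as a matrix over $R^\alpha[G_D]$).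
   Context: Green's relations ($S^1$ = $S$ with identity adjoined): $x\le_{\mathcal R}y$ iff $x\in yS^1$, $x\le_{\mathcal L}y$ iff $x\in S^1y$, $x\le_{\mathcal J}y$ iff $x\in S^1yS^1$; $\mathcal R,\mathcal L,\mathcal J$ associated equivalences; $\mathcal H=\mathcal R\cap\mathcal L$; $\mathcal D$ generated by $\mathcal R\cup\mathcal L$; for finite $S$, $\mathcal D=\mathcal J$ and $<_{\mathcal D}$ is the strict order on $\mathcal D$-classes induced by $\le_{\mathcal J}$ ($x<_{\mathcal D}D$: class of $x$ strictly below $D$). For $L,K$ in $D$, $u_Lu_K^*$ always lies either in $G_D$ or strictly below $D$. An anti-involution of $S$: $(x^* )^*=x$, $(xy)^*=y^*x^*$. A twisting satisfies $\alpha(x,y)\alpha(xy,z)=\alpha(x,yz)\alpha(y,z)$; $R^\alpha[S]$ is the algebra with basis $S$ and product $x\cdot y=\alpha(x,y)(xy)$, and $R^\alpha[G_D]$ the subalgebra spanned by $G_D$. Cellular algebra with cell datum $(\Lambda,M,C,* )$: (C1) $\Lambda$ finite poset, $\{C^\lambda_{st}:s,t\in M(\lambda)\}$ an $R$-basis; (C2) $*$ an anti-involution with $(C^\lambda_{st})^*=C^\lambda_{ts}$; (C3) for all $\lambda,s,a$ there are $r_a(s',s)\in R$ with $aC^\lambda_{st}\in\sum_{s'}r_a(s',s)C^\lambda_{s't}+A(<\lambda)$ for all $t$, $A(<\lambda)$ being the span of the $C^\mu_{uv}$ with $\mu<\lambda$. *)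

(* Defs.v *)
From HB Require Import structures.
From mathcomp Require Import all_boot all_order all_algebra.
Set Implicit Arguments. Unset Strict Implicit. Unset Printing Implicit Defensive.
Import GRing.Theory.
Local Open Scope ring_scope.

Section Green.
Variables (S : finType) (mul : S -> S -> S).

Definition leR (x y : S) : bool := (x == y) || [exists s, x == mul y s].
Definition leL (x y : S) : bool := (x == y) || [exists s, x == mul s y].
Definition leJ (x y : S) : bool :=
  [|| x == y, [exists s, x == mul s y], [exists t, x == mul y t]
    | [exists s, exists t, x == mul (mul s y) t]].

Definition Rrel (x y : S) : bool := leR x y && leR y x.
Definition Lrel (x y : S) : bool := leL x y && leL y x.
Definition Jrel (x y : S) : bool := leJ x y && leJ y x.
Definition Hrel (x y : S) : bool := Rrel x y && Lrel x y.
(* D = equivalence generated by R \cup L (R, L symmetric, so the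
   reflexive-transitive closure is already an equivalence). *)
Definition Drel (x y : S) : bool := connect (fun a b => Rrel a b || Lrel a b) x y.

Definition Lclass (x : S) : {set S} := [set y | Lrel x y].
Definition Hclass (x : S) : {set S} := [set y | Hrel x y].
Definition Dclass (x : S) : {set S} := [set y | Drel x y].

Definition Dclasses : {set {set S}} := [set Dclass x | x : S].
Definition Lclasses_in (D : {set S}) : {set {set S}} := [set Lclass x | x in D].

End Green.

Section Twisted.
Variables (R : fieldType) (S : finType) (mul : S -> S -> S) (alpha : S -> S -> R).

(* elements of R^alpha[S] are coefficient functions S -> R (basis S) *)
Definition basis_el (x : S) : {ffun S -> R} := [ffun z => (z == x)%:R].

(* twisted product: x . y = alpha(x,y) (xy), extended bilinearly *)
Definition tmul (a b : {ffun S -> R}) : {ffun S -> R} :=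
  [ffun z => \sum_(x : S) \sum_(y : S | mul x y == z) a x * b y * alpha x y].

Definition fscale (c : R) (a : {ffun S -> R}) : {ffun S -> R} := [ffun z => c * a z].

(* the subspace spanned by G (e.g. R^alpha[G_D]) *)
Definition supported (G : {set S}) (a : {ffun S -> R}) : Prop :=
  forall z, z \notin G -> a z = 0.

Definition star_lin (st : S -> S) (a : {ffun S -> R}) : {ffun S -> R} :=
  [ffun z => a (st z)].

Definition is_ideal (A I : {ffun S -> R} -> Prop) : Prop :=
  [/\ (forall x, I x -> A x), I 0,
      (forall x y, I x -> I y -> I (x + y)),
      (forall (c : R) x, I x -> I (fscale c x)) &
      (forall a x, A a -> I x -> I (tmul a x) /\ I (tmul x a))].

(* I^(n+1) = 0 : every product of n+1 elements of I vanishes *)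
Definition nilpotent (I : {ffun S -> R} -> Prop) : Prop :=
  exists n : nat, forall (x : {ffun S -> R}) (s : seq {ffun S -> R}),
    size s = n -> I x -> (forall y, y \in s -> I y) -> foldl tmul x s = 0.

(* finite-dimensional algebra A is semisimple: its (Jacobson) radical,
   i.e. its largest nilpotent ideal, is zero *)
Definition semisimple (A : {ffun S -> R} -> Prop) : Prop :=
  forall I, is_ideal A I -> nilpotent I -> forall x, I x -> x = 0.

Definition cellular (A : {ffun S -> R} -> Prop)
    (st : {ffun S -> R} -> {ffun S -> R}) : Prop :=
  exists (Lam : finType) (le : rel Lam) (Mt : finType) (M : Lam -> {set Mt})
         (C : Lam -> Mt -> Mt -> {ffun S -> R}),
  [/\
      [/\ reflexive le, antisymmetric le & transitive le],
      [/\ (forall l s t, s \in M l -> t \in M l -> A (C l s t)),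
      (forall a, A a -> exists c : Lam -> Mt -> Mt -> R,
          a = \sum_(l : Lam) \sum_(s in M l) \sum_(t in M l) fscale (c l s t) (C l s t)) &
      (forall c : Lam -> Mt -> Mt -> R,
          \sum_(l : Lam) \sum_(s in M l) \sum_(t in M l) fscale (c l s t) (C l s t) = 0 ->
          forall l s t, s \in M l -> t \in M l -> c l s t = 0)],
      [/\ (forall a, A a -> A (st a) /\ st (st a) = a),
          (forall a b, A a -> A b -> st (tmul a b) = tmul (st b) (st a)) &
          (forall l s t, s \in M l -> t \in M l -> st (C l s t) = C l t s)] &
      (forall l s a, s \in M l -> A a ->
         exists r : Mt -> R, forall t, t \in M l ->
           exists c : Lam -> Mt -> Mt -> R,
             tmul a (C l s t) =
               \sum_(s' in M l) fscale (r s') (C l s' t) +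
               \sum_(m : Lam | le m l && (m != l))
                  \sum_(u in M m) \sum_(v in M m) fscale (c m u v) (C m u v))].

Definition mxmul (Ls : {set {set S}})
    (P Q : {set S} -> {set S} -> {ffun S -> R}) (L K : {set S}) : {ffun S -> R} :=
  \sum_(J in Ls) tmul (P L J) (Q J K).

Definition mx_invertible (A : {ffun S -> R} -> Prop) (Ls : {set {set S}})
    (P : {set S} -> {set S} -> {ffun S -> R}) : Prop :=
  exists (Q : {set S} -> {set S} -> {ffun S -> R}) (e : {ffun S -> R}),
  [/\ A e, (forall a, A a -> tmul e a = a /\ tmul a e = a),
      (forall L K, L \in Ls -> K \in Ls -> A (Q L K)) &
      (forall L K, L \in Ls -> K \in Ls ->
         mxmul Ls P Q L K = (if L == K then e else 0) /\
         mxmul Ls Q P L K = (if L == K then e else 0))].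

(* (P_D^alpha)_{LK} = alpha(u_L,u_K^* ) u_L u_K^*  if u_L u_K^* \in G_D, and 0
   otherwise (i.e. when u_L u_K^* <_D D) *)
Definition Pmx (G : {set S}) (st : S -> S) (u : {set S} -> S)
    (L K : {set S}) : {ffun S -> R} :=
  if mul (u L) (st (u K)) \in G
  then fscale (alpha (u L) (st (u K))) (basis_el (mul (u L) (st (u K))))
  else 0.

End Twisted.

(* Main.v *)
Require Import Defs.
From HB Require Import structures.
From mathcomp Require Import all_boot all_order all_algebra.
Import GRing.Theory.
Local Open Scope ring_scope.

(** A twisting stays one when [alpha] is set to 0 on the products that leave the
    up-set of [e = 1_D]; on the span of [D] the twisted product [**] obtained in
    this way is that of the principal factor of [D], a Munn algebra over
    [R^alpha[G_D]] with sandwich matrix [P_D]: since [alpha] does not vanish on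
    [L_e * R_e], every element of [D] is a multiple of a product
    [u_L^* ** g ** u_K] with [g] in [R^alpha[G_D]], and the [u_L^*] are
    independent for right coefficients supported on [R_e].  In these coordinates the element
    [gram], the sum of the [u_L^* ** u_L], is the identity matrix up to
    nonzero scalars, so that multiplication by it amounts to multiplication
    by [P_D].

    If [R^alpha[S]] is semisimple, then the span of each down-set [T] of the
    [J]-order has an identity [f], by induction on [T].  When a top class [D] is
    added, the elements [y] with [y f = 0] that are annihilated by [D] modulo
    lower terms form an ideal of square zero.  Hence multiplication by [gram]
    is injective, so bijective, on the span of [D]; this gives both the inverse
    of [P_D] and an identity [h] modulo lower terms, and [f + h - h f] is the new
    identity.  A nilpotent ideal of [R^alpha[G_D]] is then, up to
    lower terms, the corner of a nilpotent ideal of [R^alpha[S]] killed by [f].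

    Conversely, let [I] be a nilpotent ideal, [y] in [I], and [D] a maximal class
    meeting the support of [y].  The parts in [G_D] of the elements [u_L y u_K^*]
    lie in a nilpotent ideal of [R^alpha[G_D]], so they vanish; the inverse of
    [P_D] then shows that [y] vanishes on [D]. *)

(** * Twisted semigroup algebras *)

Section TwistedAlgebra.
Set Implicit Arguments. Unset Strict Implicit.
Variables (R : fieldType) (S : finType) (mul : S -> S -> S).
Implicit Types (a b c : {ffun S -> R}) (x y z : S) (k : R).

Lemma fscaleDr k a b : fscale k (a + b) = fscale k a + fscale k b.
Proof. by apply/ffunP=> z; rewrite !ffunE mulrDr. Qed.

Lemma fscale0r k : fscale k (0 : {ffun S -> R}) = 0.
Proof. by apply/ffunP=> z; rewrite !ffunE mulr0. Qed.

Lemma fscale1 a : fscale 1 a = a.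
Proof. by apply/ffunP=> z; rewrite !ffunE mul1r. Qed.

Lemma fscaleN1 a : fscale (-1) a = - a.
Proof. by apply/ffunP=> z; rewrite !ffunE mulN1r. Qed.

Lemma fscaleA k l a : fscale k (fscale l a) = fscale (k * l) a.
Proof. by apply/ffunP=> z; rewrite !ffunE mulrA. Qed.

Lemma fscaleK k a : k != 0 -> fscale k^-1 (fscale k a) = a.
Proof. by move=> k0; rewrite fscaleA mulVf // fscale1. Qed.

Lemma ffun_basis a : a = \sum_x fscale (a x) (basis_el R x).
Proof.
apply/ffunP=> z; rewrite sum_ffunE (bigD1 z) //= !ffunE eqxx mulr1.
rewrite big1 ?addr0 // => x xz.
by rewrite !ffunE eq_sym (negbTE xz) mulr0.
Qed.

Lemma lin_ind (P : {ffun S -> R} -> Prop) a :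
  P 0 -> (forall b c, P b -> P c -> P (b + c)) ->
  (forall k b, P b -> P (fscale k b)) ->
  (forall x, a x != 0 -> P (basis_el R x)) -> P a.
Proof.
move=> P0 PD PZ Pb; rewrite (ffun_basis a).
apply: big_ind => // x _; have [ax0|ax0] := eqVneq (a x) 0.
  suff -> : fscale (a x) (basis_el R x) = 0 by [].
  by apply/ffunP=> z; rewrite !ffunE ax0 mul0r.
by apply: PZ; apply: Pb.
Qed.

(** * Spans of subsets of the basis *)

Section Supported.
Variable G : {set S}.

Lemma supported0 : supported G (0 : {ffun S -> R}).
Proof. by move=> z _; rewrite ffunE. Qed.

Lemma supportedD a b : supported G a -> supported G b -> supported G (a + b).
Proof. by move=> Ga Gb z Gz; rewrite ffunE Ga // Gb // addr0. Qed.

Lemma supportedZ k a : supported G a -> supported G (fscale k a).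
Proof. by move=> Ga z Gz; rewrite ffunE Ga // mulr0. Qed.

Lemma supportedN a : supported G a -> supported G (- a).
Proof. by rewrite -fscaleN1; apply: supportedZ. Qed.

Lemma supportedB a b : supported G a -> supported G b -> supported G (a - b).
Proof. by move=> Ga /supportedN; apply: supportedD. Qed.

Lemma supported_sum (I : Type) (r : seq I) (P : pred I) (F : I -> {ffun S -> R}) :
  (forall i, P i -> supported G (F i)) -> supported G (\sum_(i <- r | P i) F i).
Proof. by move=> GF; apply: big_ind => //; [apply: supported0|apply: supportedD]. Qed.

Lemma supported_basis x : x \in G -> supported G (basis_el R x).
Proof. by move=> Gx z Gz; rewrite ffunE; case: eqP => // zx; rewrite zx Gx in Gz. Qed.

Lemma supported_in a x : supported G a -> a x != 0 -> x \in G.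
Proof. by move=> Ga; apply: contraNT => /Ga ->. Qed.

Lemma supported_ind (P : {ffun S -> R} -> Prop) a :
  supported G a ->
  P 0 -> (forall b c, P b -> P c -> P (b + c)) ->
  (forall k b, P b -> P (fscale k b)) ->
  (forall x, x \in G -> P (basis_el R x)) -> P a.
Proof.
move=> Ga P0 PD PZ Pb; apply: lin_ind => // x ax.
exact: Pb (supported_in Ga ax).
Qed.

End Supported.

Lemma supportedS (G H : {set S}) a : G \subset H -> supported G a -> supported H a.
Proof. by move=> /subsetP GH Ga z; apply: contraNeq => /(supported_in Ga)/GH. Qed.

Definition restr (G : {set S}) a : {ffun S -> R} := [ffun z => if z \in G then a z else 0].

Lemma supported_restr G a : supported G (restr G a).
Proof. by move=> z Gz; rewrite ffunE (negbTE Gz). Qed.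

Lemma restr_id G a : supported G a -> restr G a = a.
Proof. by move=> Ga; apply/ffunP=> z; rewrite ffunE; case: ifPn => // /Ga. Qed.

Lemma restrD G a b : restr G (a + b) = restr G a + restr G b.
Proof. by apply/ffunP=> z; rewrite !ffunE; case: ifP => _; rewrite ?addr0. Qed.

Lemma restrZ G k a : restr G (fscale k a) = fscale k (restr G a).
Proof. by apply/ffunP=> z; rewrite !ffunE; case: ifP => _; rewrite ?mulr0. Qed.

Lemma restrB_id G a : restr G (a - restr G a) = 0.
Proof. by apply/ffunP=> z; rewrite !ffunE; case: ifP => // ->; rewrite subrr. Qed.

(** * The twisted product: bilinearity, associativity, anti-involution *)

Section Product.
Variable alpha : S -> S -> R.
Local Notation "a ** b" := (tmul mul alpha a b) (at level 40, left associativity).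

Lemma tmulDl a b c : (a + b) ** c = a ** c + b ** c.
Proof.
apply/ffunP=> z; rewrite !ffunE -big_split; apply: eq_bigr => x _.
by rewrite -big_split; apply: eq_bigr => y _; rewrite /= ffunE !mulrDl.
Qed.

Lemma tmulDr a b c : a ** (b + c) = a ** b + a ** c.
Proof.
apply/ffunP=> z; rewrite !ffunE -big_split; apply: eq_bigr => x _.
by rewrite -big_split; apply: eq_bigr => y _; rewrite /= ffunE mulrDr mulrDl.
Qed.

Lemma tmulZl k a b : fscale k a ** b = fscale k (a ** b).
Proof.
apply/ffunP=> z; rewrite !ffunE mulr_sumr; apply: eq_bigr => x _.
by rewrite mulr_sumr; apply: eq_bigr => y _; rewrite /= ffunE !mulrA.
Qed.

Lemma tmulZr k a b : a ** fscale k b = fscale k (a ** b).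
Proof.
apply/ffunP=> z; rewrite !ffunE mulr_sumr; apply: eq_bigr => x _.
by rewrite mulr_sumr; apply: eq_bigr => y _; rewrite /= ffunE !mulrA (mulrC (a x)).
Qed.

Lemma tmul0l a : 0 ** a = 0.
Proof. by apply: (addrI (0 ** a)); rewrite -tmulDl !addr0. Qed.

Lemma tmul0r a : a ** 0 = 0.
Proof. by apply: (addrI (a ** 0)); rewrite -tmulDr !addr0. Qed.

Lemma tmulNl a b : (- a) ** b = - (a ** b).
Proof. by rewrite -fscaleN1 tmulZl fscaleN1. Qed.

Lemma tmulNr a b : a ** (- b) = - (a ** b).
Proof. by rewrite -fscaleN1 tmulZr fscaleN1. Qed.

Lemma tmulBl a b c : (a - b) ** c = a ** c - b ** c.
Proof. by rewrite tmulDl tmulNl. Qed.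

Lemma tmulBr a b c : a ** (b - c) = a ** b - a ** c.
Proof. by rewrite tmulDr tmulNr. Qed.

Lemma tmul_suml (I : Type) (r : seq I) (P : pred I) (F : I -> {ffun S -> R}) b :
  (\sum_(i <- r | P i) F i) ** b = \sum_(i <- r | P i) F i ** b.
Proof. by apply: (big_morph (fun a => a ** b)) => [a c|]; rewrite ?tmulDl ?tmul0l. Qed.

Lemma tmul_sumr (I : Type) (r : seq I) (P : pred I) (F : I -> {ffun S -> R}) b :
  b ** (\sum_(i <- r | P i) F i) = \sum_(i <- r | P i) b ** F i.
Proof. by apply: (big_morph (fun a => b ** a)) => [a c|]; rewrite ?tmulDr ?tmul0r. Qed.

Lemma tmul_basis x y :
  basis_el R x ** basis_el R y = fscale (alpha x y) (basis_el R (mul x y)).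
Proof.
apply/ffunP=> z; rewrite !ffunE (bigD1 x) //= [X in _ + X]big1 ?addr0; last first.
  by move=> x' xx'; rewrite big1 // => y' _; rewrite ffunE (negbTE xx') !mul0r.
rewrite big_mkcond (bigD1 y) //= [X in _ + X]big1 ?addr0; last first.
  by move=> y' yy'; rewrite !ffunE (negbTE yy') mulr0 mul0r if_same.
rewrite !ffunE !eqxx !mul1r eq_sym.
by case: eqP => _; rewrite ?mulr1 ?mulr0.
Qed.

Lemma tmul_basisl x a z :
  (basis_el R x ** a) z = \sum_(y | mul x y == z) a y * alpha x y.
Proof.
rewrite ffunE (bigD1 x) //= [X in _ + X]big1 ?addr0; last first.
  by move=> x' xx'; rewrite big1 // => y _; rewrite ffunE (negbTE xx') !mul0r.
by apply: eq_bigr => y _; rewrite ffunE eqxx mul1r.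
Qed.

(** Only pairs with [alpha x y != 0] contribute; for a truncated twisting this leaves only the
    products that survive the truncation. *)
Lemma supported_tmul (G H K : {set S}) a b :
  (forall x y, x \in G -> y \in H -> alpha x y != 0 -> mul x y \in K) ->
  supported G a -> supported H b -> supported K (a ** b).
Proof.
move=> GHK Ga Hb z Kz; rewrite ffunE big1 // => x _; rewrite big1 // => y /eqP xyz.
apply: contraNeq Kz; rewrite !mulf_eq0 !negb_or => /andP[/andP[ax by_] xy].
by rewrite -xyz; apply: GHK => //; [exact: supported_in ax|exact: supported_in by_].
Qed.

Lemma foldl_tmul0 s : foldl (tmul mul alpha) 0 s = 0.
Proof. by elim: s => //= b s; rewrite tmul0l. Qed.

Lemma foldl_tmulD a b s :
  foldl (tmul mul alpha) (a + b) s =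
  foldl (tmul mul alpha) a s + foldl (tmul mul alpha) b s.
Proof. by elim: s a b => //= c s IHs a b; rewrite tmulDl IHs. Qed.

Hypothesis mulA : associative mul.
Hypothesis alphaA : forall x y z,
  alpha x y * alpha (mul x y) z = alpha x (mul y z) * alpha y z.

Lemma tmulA a b c : a ** (b ** c) = a ** b ** c.
Proof.
apply: (lin_ind (P := fun a => a ** (b ** c) = a ** b ** c)) => [|a1 a2 h1 h2|k a1 h|x _].
- by rewrite !tmul0l.
- by rewrite !tmulDl h1 h2.
- by rewrite !tmulZl h.
apply: (lin_ind (P := fun b => _ ** (b ** c) = _ ** b ** c)) => [|a1 a2 h1 h2|k a1 h|y _].
- by rewrite !(tmul0l, tmul0r).
- by rewrite !(tmulDl, tmulDr) h1 h2.
- by rewrite !(tmulZl, tmulZr) h.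
apply: (lin_ind (P := fun c => _ ** (_ ** c) = _ ** _ ** c)) => [|a1 a2 h1 h2|k a1 h|z _].
- by rewrite !tmul0r.
- by rewrite !tmulDr h1 h2.
- by rewrite !tmulZr h.
rewrite !tmul_basis tmulZl tmulZr !tmul_basis !fscaleA mulA; congr (fscale _ _).
by rewrite alphaA mulrC.
Qed.

Variable st : S -> S.
Hypothesis stK : involutive st.
Hypothesis stM : forall x y, st (mul x y) = mul (st y) (st x).
Hypothesis alpha_st : forall x y, alpha x y = alpha (st y) (st x).

Lemma star_linK : involutive (@star_lin R S st).
Proof. by move=> a; apply/ffunP=> z; rewrite !ffunE stK. Qed.

Lemma star_linD a b : star_lin st (a + b) = star_lin st a + star_lin st b.
Proof. by apply/ffunP=> z; rewrite !ffunE. Qed.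

Lemma star_linZ k a : star_lin st (fscale k a) = fscale k (star_lin st a).
Proof. by apply/ffunP=> z; rewrite !ffunE. Qed.

Lemma star_lin0 : star_lin st (0 : {ffun S -> R}) = 0.
Proof. by apply/ffunP=> z; rewrite !ffunE. Qed.

Lemma star_lin_sum (I : Type) (r : seq I) (P : pred I) (F : I -> {ffun S -> R}) :
  star_lin st (\sum_(i <- r | P i) F i) = \sum_(i <- r | P i) star_lin st (F i).
Proof. by apply: (big_morph (star_lin st)) => [a c|]; rewrite ?star_linD ?star_lin0. Qed.

Lemma star_lin_basis x : star_lin st (basis_el R x) = basis_el R (st x).
Proof. by apply/ffunP=> z; rewrite !ffunE (inv_eq stK). Qed.

Lemma star_lin_tmul a b : star_lin st (a ** b) = star_lin st b ** star_lin st a.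
Proof.
apply: (lin_ind (P := fun a => star_lin st (a ** b) = star_lin st b ** star_lin st a))
    => [|a1 a2 h1 h2|k a1 h|x _].
- by rewrite star_lin0 tmul0l tmul0r star_lin0.
- by rewrite tmulDl !star_linD tmulDr h1 h2.
- by rewrite tmulZl !star_linZ tmulZr h.
apply: (lin_ind (P := fun b => star_lin st (_ ** b) = star_lin st b ** _))
    => [|a1 a2 h1 h2|k a1 h|y _].
- by rewrite star_lin0 tmul0l tmul0r star_lin0.
- by rewrite tmulDr !star_linD tmulDl h1 h2.
- by rewrite tmulZr !star_linZ tmulZl h.
by rewrite tmul_basis star_linZ !star_lin_basis tmul_basis stM -alpha_st.
Qed.

Lemma star_lin_supported (G H : {set S}) a :
  (forall x, (st x \in G) = (x \in H)) -> supported G a -> supported H (star_lin st a).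
Proof. by move=> GH Ga z Hz; rewrite ffunE Ga // GH. Qed.

End Product.

(** On row vectors of coefficients [f] acts by a square matrix [M]; injectivity makes the kernel of
    [M] trivial, so [M] is invertible. *)
Lemma lin_inj_surj (f : {ffun S -> R} -> {ffun S -> R}) :
  (forall a b, f (a + b) = f a + f b) ->
  (forall k a, f (fscale k a) = fscale k (f a)) ->
  (forall a, f a = 0 -> a = 0) -> forall b, exists a, f a = b.
Proof.
move=> fD fZ f0 b.
pose M := \matrix_(i < #|S|, j < #|S|) f (basis_el R (enum_val i)) (enum_val j).
pose toF (v : 'rV[R]_#|S|) : {ffun S -> R} := [ffun x => v 0 (enum_rank x)].
have f00 : f 0 = 0 by apply: (addrI (f 0)); rewrite -fD !addr0.
have fE v : f (toF v) = toF (v *m M).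
  rewrite (ffun_basis (toF v)).
  rewrite (big_morph f (id1 := 0) (op1 := +%R)) //.
  apply/ffunP=> z; rewrite sum_ffunE !ffunE !mxE (reindex (@enum_val S S)) /=; last first.
    by apply: onW_bij; apply: enum_val_bij.
  apply: eq_bigr => i _.
  by rewrite fZ !ffunE mxE enum_valK enum_rankK.
have toF0 v : toF v = 0 -> v = 0.
  move=> /ffunP vz; apply/rowP=> i; have := vz (enum_val i).
  by rewrite !ffunE enum_valK !mxE.
have Mfree : M \in unitmx.
  rewrite -row_free_unit -kermx_eq0; apply/eqP/row_matrixP=> i; rewrite row0.
  apply: toF0; apply: f0; rewrite fE -row_mul mulmx_ker row0.
  by apply/ffunP=> z; rewrite !ffunE mxE.
exists (toF ((\row_i b (enum_val i)) *m invmx M)).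
rewrite fE mulmxKV //; apply/ffunP=> z.
by rewrite ffunE mxE enum_rankK.
Qed.

End TwistedAlgebra.

(** * Green's relations in a finite semigroup *)

Section GreenRight.
Set Implicit Arguments. Unset Strict Implicit.
Variables (S : finType) (mul : S -> S -> S).
Hypothesis mulA : associative mul.
Implicit Types x y z s : S.

Lemma leRP x y : reflect (x = y \/ exists s, x = mul y s) (leR mul x y).
Proof.
apply: (iffP orP) => [[/eqP|/existsP[s /eqP]]|[->|[s ->]]]; [by left|by right; exists s|..].
  by left.
by right; apply/existsP; exists s.
Qed.

Lemma leR_refl : reflexive (leR mul).
Proof. by move=> x; apply/leRP; left. Qed.

Lemma leRM x s : leR mul (mul x s) x.
Proof. by apply/leRP; right; exists s. Qed.

Lemma leR_trans : transitive (leR mul).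
Proof.
move=> y x z /leRP[->//|[s ->]] /leRP[->|[t ->]]; first exact: leRM.
by rewrite -mulA leRM.
Qed.

Lemma leR_mul2l s x y : leR mul x y -> leR mul (mul s x) (mul s y).
Proof. by case/leRP=> [->|[t ->]]; rewrite ?leR_refl // mulA leRM. Qed.

Lemma Rrel_mul2l s x y : Rrel mul x y -> Rrel mul (mul s x) (mul s y).
Proof. by case/andP=> xy yx; rewrite /Rrel !leR_mul2l. Qed.

Lemma Rrel_refl : reflexive (Rrel mul).
Proof. by move=> x; rewrite /Rrel leR_refl. Qed.

Lemma Rrel_sym : symmetric (Rrel mul).
Proof. by move=> x y; rewrite /Rrel andbC. Qed.

Lemma Rrel_trans : transitive (Rrel mul).
Proof.
move=> y x z /andP[xy yx] /andP[yz zy].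
by rewrite /Rrel (leR_trans xy yz) (leR_trans zy yx).
Qed.

Lemma leR_idem e x : mul e e = e -> leR mul x e -> mul e x = x.
Proof. by move=> ee /leRP[->//|[s ->]]; rewrite mulA ee. Qed.

(* The right ideal of [mul s x] is an image of that of [x], so the cardinals
   of these ideals force equality. *)
Lemma leR_stable x y z : leR mul x y -> leR mul y z -> leL mul z x -> leR mul y x.
Proof.
pose rid a := [set b | leR mul b a].
have ridS a b : leR mul a b -> rid a \subset rid b.
  by move=> ab; apply/subsetP=> c; rewrite !inE => /leR_trans; apply.
move=> xy yz zx; suff: y \in rid x by rewrite inE.
have /eqP -> : rid x == rid y; last by rewrite inE leR_refl.
rewrite eqEcard (ridS _ _ xy) (leq_trans (subset_leq_card (ridS _ _ yz))) //.
case/orP: zx => [/eqP->//|/existsP[s /eqP->]].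
apply: leq_trans (leq_imset_card (mul s) (mem (rid x))).
apply/subset_leq_card/subsetP=> b; rewrite inE => /leRP[->|[t ->]].
  by apply: imset_f; rewrite inE leR_refl.
by rewrite -mulA; apply: imset_f; rewrite inE leRM.
Qed.

End GreenRight.

Section Green.
Set Implicit Arguments. Unset Strict Implicit.
Variables (S : finType) (mul : S -> S -> S).
Hypothesis mulA : associative mul.
Implicit Types x y z s : S.

Local Notation opp := (fun x y => mul y x).
(** [leL mul] is by conversion [leR] of the opposite product, so left-handed facts are instances of
    the right-handed ones. *)
Let oppA : associative opp. Proof. by move=> x y z; rewrite mulA. Qed.

Lemma leLP x y : reflect (x = y \/ exists s, x = mul s y) (leL mul x y).
Proof. exact: (@leRP S opp). Qed.

Lemma leL_refl : reflexive (leL mul).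
Proof. exact: (@leR_refl S opp). Qed.

Lemma leLM x s : leL mul (mul s x) x.
Proof. exact: (@leRM S opp). Qed.

Lemma leL_trans : transitive (leL mul).
Proof. exact: (leR_trans oppA). Qed.

Lemma Lrel_refl : reflexive (Lrel mul).
Proof. exact: (@Rrel_refl S opp). Qed.

Lemma Lrel_sym : symmetric (Lrel mul).
Proof. exact: (@Rrel_sym S opp). Qed.

Lemma Lrel_trans : transitive (Lrel mul).
Proof. exact: (Rrel_trans oppA). Qed.

Lemma leL_idem e x : mul e e = e -> leL mul x e -> mul x e = x.
Proof. exact: (leR_idem oppA). Qed.

Lemma leJP x y : reflect (exists2 z, leR mul x z & leL mul z y) (leJ mul x y).
Proof.
apply: (iffP or4P) => [[/eqP->|/existsP[s /eqP->]|/existsP[t /eqP->]|]|].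
- by exists y; rewrite ?leR_refl ?leL_refl.
- by exists (mul s y); rewrite ?leR_refl ?leLM.
- by exists y; rewrite ?leRM ?leL_refl.
- by case/existsP=> s /existsP[t /eqP->]; exists (mul s y); rewrite ?leRM ?leLM.
case=> z /leRP[->|[t ->]] /leLP[->|[s ->]]; first exact: Or41.
- by apply: Or42; apply/existsP; exists s.
- by apply: Or43; apply/existsP; exists t.
- by apply: Or44; apply/existsP; exists s; apply/existsP; exists t.
Qed.

(** Left and right multiplications commute, so the two one-sided steps of [leJ] may be taken in
    either order; transitivity of [leJ] and its invariance under [st] rest on this. *)
Lemma leJP_LR x y : reflect (exists2 z, leL mul x z & leR mul z y) (leJ mul x y).
Proof.
apply: (iffP (leJP x y)) => -[z].
- move=> /leRP[->|[t ->]] /leLP[->|[s ->]].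
  + by exists y; rewrite ?leR_refl ?leL_refl.
  + by exists y; rewrite ?leR_refl ?leLM.
  + by exists (mul y t); rewrite ?leRM ?leL_refl.
  + by exists (mul y t); rewrite ?leRM // -mulA leLM.
- move=> /leLP[->|[s ->]] /leRP[->|[t ->]].
  + by exists y; rewrite ?leR_refl ?leL_refl.
  + by exists y; rewrite ?leL_refl ?leRM.
  + by exists (mul s y); rewrite ?leLM ?leR_refl.
  + by exists (mul s y); rewrite ?leLM // mulA leRM.
Qed.

Lemma leR_leJ x y : leR mul x y -> leJ mul x y.
Proof. by move=> xy; apply/leJP; exists y; rewrite ?leL_refl. Qed.

Lemma leL_leJ x y : leL mul x y -> leJ mul x y.
Proof. by move=> xy; apply/leJP; exists x; rewrite ?leR_refl. Qed.

Lemma leJ_refl : reflexive (leJ mul).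
Proof. by move=> x; apply/leR_leJ/leR_refl. Qed.

Lemma leJ_trans : transitive (leJ mul).
Proof.
move=> y x z /leJP[a xa ay] /leJP[b yb bz].
have /leJP_LR/leJP[c ac cb] : exists2 c, leL mul a c & leR mul c b by exists y.
by apply/leJP; exists c; [exact: leR_trans mulA _ _ _ xa ac|exact: leL_trans cb bz].
Qed.

Lemma leJMl s x : leJ mul (mul s x) x. Proof. exact/leL_leJ/leLM. Qed.
Lemma leJMr s x : leJ mul (mul x s) x. Proof. exact/leR_leJ/leRM. Qed.

(** Stability of finite semigroups: [leJP] splits [leJ mul y x] into the two one-sided steps that
    [leR_stable] expects. *)
Lemma stableR x y : leR mul x y -> leJ mul y x -> Rrel mul x y.
Proof. by move=> xy /leJP[z yz zx]; rewrite /Rrel xy (leR_stable mulA xy yz zx). Qed.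

Lemma stableL x y : leL mul x y -> leJ mul y x -> Lrel mul x y.
Proof.
by move=> xy /leJP_LR[z yz zx]; rewrite /Lrel xy; apply: (leR_stable oppA xy yz zx).
Qed.

Lemma Jrel_refl : reflexive (Jrel mul).
Proof. by move=> x; rewrite /Jrel leJ_refl. Qed.

Lemma Jrel_sym : symmetric (Jrel mul).
Proof. by move=> x y; rewrite /Jrel andbC. Qed.

Lemma Jrel_trans : transitive (Jrel mul).
Proof.
move=> y x z /andP[xy yx] /andP[yz zy].
by rewrite /Jrel (leJ_trans xy yz) (leJ_trans zy yx).
Qed.

Lemma Rrel_Jrel x y : Rrel mul x y -> Jrel mul x y.
Proof. by case/andP=> xy yx; rewrite /Jrel !leR_leJ. Qed.

Lemma Lrel_Jrel x y : Lrel mul x y -> Jrel mul x y.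
Proof. by case/andP=> xy yx; rewrite /Jrel !leL_leJ. Qed.

(** For the inclusion of J in D, the element [z] interpolating in [leJ mul x y] stays in the common
    J-class, so stability makes it R-related to [x] and L-related to [y]. *)
Lemma Drel_Jrel : Drel mul =2 Jrel mul.
Proof.
move=> x y; apply/idP/idP => [/connectP[p]|/andP[/leJP[z xz zy] yx]].
  elim: p x => [|a p IHp] x /=; first by move=> _ ->; apply: Jrel_refl.
  case/andP=> /orP[/Rrel_Jrel|/Lrel_Jrel] xa ap yE; apply: Jrel_trans xa _; exact: IHp.
have Rxz : Rrel mul x z by apply: stableR => //; apply: leJ_trans (leL_leJ zy) yx.
have Lzy : Lrel mul z y by apply: stableL => //; apply: leJ_trans yx (leR_leJ xz).
by apply: (@connect_trans _ _ z); apply: connect1; rewrite ?Rxz ?Lzy ?orbT.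
Qed.

Lemma Dclass_eq D e : D \in Dclasses mul -> e \in D -> D = [set x | Jrel mul x e].
Proof.
case/imsetP=> x _ ->; rewrite inE Drel_Jrel => xe; apply/setP=> y; rewrite !inE Drel_Jrel.
apply/idP/idP => [xy|ye]; last by rewrite (Jrel_trans xe) // Jrel_sym.
by rewrite (Jrel_trans _ xe) // Jrel_sym.
Qed.

(** Choose [x] in [T] with a principal down-set of largest cardinal: an element of [T] above [x] has
    a down-set containing that one, hence equal to it. *)
Lemma exists_leJ_max (T : {set S}) : T != set0 ->
  exists2 x, x \in T & forall z, z \in T -> leJ mul x z -> leJ mul z x.
Proof.
case/set0Pn=> x0 Tx0; pose down x := [set z | leJ mul z x].
case: (arg_maxnP (fun x => #|down x|) Tx0) => x Tx maxx.
exists x => // z Tz xz; have : z \in down z by rewrite inE leJ_refl.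
suff /eqP <- : down x == down z by rewrite inE.
rewrite eqEcard; apply/andP; split; last exact: (maxx z Tz).
by apply/subsetP=> t; rewrite !inE => tx; apply: leJ_trans tx xz.
Qed.

(** * Green's relations under the anti-involution *)

Variable st : S -> S.
Hypothesis stK : involutive st.
Hypothesis stM : forall x y, st (mul x y) = mul (st y) (st x).

Lemma leR_st x y : leR mul (st x) (st y) = leL mul x y.
Proof.
apply/leRP/leLP => -[xy|[s xy]].
- by left; apply: inv_inj xy.
- by right; exists (st s); apply: (inv_inj stK); rewrite stM stK.
- by left; rewrite xy.
- by right; exists (st s); rewrite xy stM.
Qed.

Lemma leL_st x y : leL mul (st x) (st y) = leR mul x y.
Proof. by rewrite -leR_st !stK. Qed.

Lemma Rrel_st x y : Rrel mul (st x) (st y) = Lrel mul x y.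
Proof. by rewrite /Rrel !leR_st. Qed.

Lemma leJ_st x y : leJ mul (st x) (st y) = leJ mul x y.
Proof.
suff imp a b : leJ mul a b -> leJ mul (st a) (st b).
  by apply/idP/idP => /imp; rewrite ?stK.
by case/leJP=> z az zb; apply/leJP_LR; exists (st z); rewrite ?leL_st ?leR_st.
Qed.

Lemma Jrel_st x y : Jrel mul (st x) (st y) = Jrel mul x y.
Proof. by rewrite /Jrel !leJ_st. Qed.

End Green.

(** * The principal factor of a regular class *)

Section PrincipalFactor.
Set Implicit Arguments. Unset Strict Implicit.
Variables (R : fieldType) (S : finType) (mul : S -> S -> S) (st : S -> S).
Variables (alpha : S -> S -> R) (e : S).
Hypothesis mulA : associative mul.
Hypothesis stK : involutive st.
Hypothesis stM : forall x y, st (mul x y) = mul (st y) (st x).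
Hypothesis alphaA : forall x y z,
  alpha x y * alpha (mul x y) z = alpha x (mul y z) * alpha y z.
Hypothesis alpha_st : forall x y, alpha x y = alpha (st y) (st x).
Hypothesis ee : mul e e = e.
Hypothesis ste : st e = e.
Hypothesis alpha_neq0 : forall x y, Lrel mul x e -> Rrel mul y e -> alpha x y != 0.
Implicit Types (a b c : {ffun S -> R}) (x z : S) (k : R).

(* On the span of the class of [e], the twisted product of [alphaD] is that of
   the principal factor. *)
Definition alphaD x y := if leJ mul e (mul x y) then alpha x y else 0.

Local Notation "a ** b" := (tmul mul alphaD a b) (at level 40, left associativity).
Local Notation be := (basis_el R).
Local Notation up := [set x | leJ mul e x].
Local Notation D := [set x | Jrel mul x e].
Local Notation Re := [set x | Rrel mul x e].
Local Notation Le := [set x | Lrel mul x e].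
Local Notation G := (Hclass mul e).

(** If the triple product lies above [e], so do both partial products, and this is the identity for
    [alpha]; otherwise a factor vanishes on each side. *)
Lemma alphaDA x y z :
  alphaD x y * alphaD (mul x y) z = alphaD x (mul y z) * alphaD y z.
Proof.
rewrite /alphaD mulA; have [exyz|_] := boolP (leJ mul e (mul (mul x y) z)).
  rewrite (leJ_trans mulA exyz (leJMr _ _ _)) alphaA.
  by rewrite ifT //; apply: leJ_trans exyz _ => //; rewrite -mulA leJMl.
by rewrite mulr0 mul0r.
Qed.

Lemma alphaD_st x y : alphaD x y = alphaD (st y) (st x).
Proof. by rewrite /alphaD -stM -{2}ste (leJ_st mulA stK stM) -alpha_st. Qed.

Lemma alphaD_up x y : alphaD x y != 0 -> leJ mul e (mul x y).
Proof. by rewrite /alphaD; case: ifP => //; rewrite eqxx. Qed.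

Lemma tmulDA a b c : a ** (b ** c) = a ** b ** c.
Proof. exact: tmulA mulA alphaDA _ _ _. Qed.

Lemma star_tmulD a b : star_lin st (a ** b) = star_lin st b ** star_lin st a.
Proof. exact: star_lin_tmul stK stM alphaD_st _ _. Qed.

Lemma supported_up a b : supported up (a ** b).
Proof.
apply: (supported_tmul (G := setT) (H := setT)) => [x y _ _ /alphaD_up|z|z].
- by rewrite inE.
- by rewrite inE.
- by rewrite inE.
Qed.

Lemma tmulD_up a b z : leJ mul e z -> tmul mul alpha a b z = (a ** b) z.
Proof.
move=> ez; rewrite !ffunE; apply: eq_bigr => x _; apply: eq_bigr => y /eqP xyz.
by rewrite /alphaD xyz ez.
Qed.

(** A product above [e] has both factors above [e], so [**] ignores all coefficients outside the
    up-set of [e]. *)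
Lemma eq_tmulD a a' b b' :
  (forall z, leJ mul e z -> a z = a' z) -> (forall z, leJ mul e z -> b z = b' z) ->
  a ** b = a' ** b'.
Proof.
move=> aa bb; apply/ffunP=> z.
have [ez|ez] := boolP (leJ mul e z); last by rewrite !supported_up ?inE.
rewrite !ffunE; apply: eq_bigr => x _; apply: eq_bigr => y /eqP xyz.
rewrite aa ?bb //; apply: leJ_trans ez _ => //; rewrite -xyz ?leJMl ?leJMr //.
Qed.

Lemma tmulD_tmull a b c : tmul mul alpha a b ** c = a ** b ** c.
Proof. by apply: eq_tmulD => // z; apply: tmulD_up. Qed.

Lemma tmulD_tmulr a b c : c ** tmul mul alpha a b = c ** (a ** b).
Proof. by apply: eq_tmulD => // z; apply: tmulD_up. Qed.

Lemma D_up x : x \in D -> leJ mul e x.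
Proof. by rewrite inE => /andP[]. Qed.

Lemma supported_Dl a b : supported D a -> supported D (a ** b).
Proof.
move=> Da; apply: (supported_tmul (H := setT)) Da _ => [x y|z]; last by rewrite inE.
rewrite !inE => /andP[xe ex] _ /alphaD_up exy; rewrite /Jrel exy andbT.
exact: leJ_trans (leJMr _ _ _) xe.
Qed.

Lemma supported_Dr a b : supported D b -> supported D (a ** b).
Proof.
move=> Db; apply: (supported_tmul (G := setT)) Db => [x y _|z]; last by rewrite inE.
rewrite !inE => /andP[xe ex] /alphaD_up exy; rewrite /Jrel exy andbT.
exact: leJ_trans (leJMl _ _ _) xe.
Qed.

Lemma mem_Re x : leR mul x e -> leJ mul e x -> x \in Re.
Proof. by rewrite inE; apply: stableR. Qed.

Lemma supported_Re a b : supported Re a -> supported Re (a ** b).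
Proof.
move=> Ra; apply: (supported_tmul (H := setT)) Ra _ => [x y|z]; last by rewrite inE.
rewrite inE => /andP[xe _] _ /alphaD_up; apply: mem_Re.
exact: leR_trans (leRM _ _ _) xe.
Qed.

Lemma supported_Le a b : supported Le b -> supported Le (a ** b).
Proof.
move=> Lb; apply: (supported_tmul (G := setT)) Lb => [x y _|z]; last by rewrite inE.
rewrite inE => /andP[xe _] /alphaD_up; rewrite inE; apply: stableL => //.
exact: leL_trans (leLM _ _ _) xe.
Qed.

Lemma G_ReLe x : (x \in G) = (x \in Re) && (x \in Le).
Proof. by rewrite !inE /Hrel Rrel_sym Lrel_sym. Qed.

Lemma supported_G a : supported Re a -> supported Le a -> supported G a.
Proof. by move=> Ra La z; rewrite G_ReLe negb_and => /orP[/Ra|/La]. Qed.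

Lemma supported_GRe a : supported G a -> supported Re a.
Proof. by apply: supportedS; apply/subsetP=> x; rewrite G_ReLe => /andP[]. Qed.

Lemma supported_GLe a : supported G a -> supported Le a.
Proof. by apply: supportedS; apply/subsetP=> x; rewrite G_ReLe => /andP[]. Qed.

Lemma supported_ReD a : supported Re a -> supported D a.
Proof. by apply: supportedS; apply/subsetP=> x; rewrite !inE; apply: Rrel_Jrel. Qed.

Lemma supported_LeD a : supported Le a -> supported D a.
Proof. by apply: supportedS; apply/subsetP=> x; rewrite !inE; apply: Lrel_Jrel. Qed.

Lemma supported_GD a : supported G a -> supported D a.
Proof. by move/supported_GRe/supported_ReD. Qed.

(** The H-class of the idempotent [e] is closed under [mul], so nothing is truncated there and [**]
    is the product of [R^alpha[G_D]]. *)
Lemma tmulD_G a b : supported G a -> supported G b -> tmul mul alpha a b = a ** b.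
Proof.
move=> Ga Gb; apply/ffunP=> z.
have [ez|ez] := boolP (leJ mul e z); first exact: tmulD_up.
rewrite [RHS]supported_up ?inE //.
suff Gab : supported G (tmul mul alpha a b).
  by apply: (supported_GD Gab); apply: contraNN ez => /D_up.
apply: supported_tmul Ga Gb => x y; rewrite !G_ReLe !inE => /andP[Rx Lx] /andP[Ry Ly] _.
(* As [mul x e = x], left multiplication by [x] carries the R-relation of [y] and [e] to that of
   [mul x y] and [x]; the L-part is dual, through [st]. *)
apply/andP; split; first by rewrite -(leL_idem mulA ee (proj1 (andP Lx))) in Rx;
  apply: Rrel_trans Rx => //; apply: Rrel_mul2l.
have := Rrel_mul2l mulA (st y) (x := st x) (y := e).
rewrite -{1 2}ste -stM !Rrel_st // => /(_ Lx); rewrite ste => Lxy.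
apply: Lrel_trans Ly => //; move: Lxy.
by rewrite -{1}ste -stM Rrel_st // (leR_idem mulA ee) //; case/andP: Ry.
Qed.

(** The identity of [R^alpha[G_D]]: the basis element of [e] squares to [alpha e e] times itself. *)
Definition unitG : {ffun S -> R} := fscale (alpha e e)^-1 (be e).

Lemma alpha_ee : alpha e e != 0.
Proof. by apply: alpha_neq0; [exact: Lrel_refl|exact: Rrel_refl]. Qed.

Lemma mem_G_e : e \in G.
Proof. by rewrite G_ReLe !inE Rrel_refl Lrel_refl. Qed.

Lemma supported_unitG : supported G unitG.
Proof. exact/supportedZ/supported_basis/mem_G_e. Qed.

(** The twisting identity at [(e, e, x)], with the nonzero factor [alpha e x] cancelled, gives
    [alpha e x = alpha e e] for [x] in [Re]. *)
Lemma unitG_tmul a : supported Re a -> unitG ** a = a.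
Proof.
move=> Ra; apply: (supported_ind (P := fun a => unitG ** a = a)) Ra _ _ _ _
  => [|b c hb hc|k b hb|x]; rewrite ?tmul0r ?tmulDr ?tmulZr ?hb ?hc //.
rewrite inE => Rx; rewrite tmulZl tmul_basis.
have ex : mul e x = x by apply: (leR_idem mulA ee); case/andP: Rx.
rewrite /alphaD ex; have /andP[_ -> ] := Rrel_Jrel Rx.
have aex : alpha e x != 0 by apply: alpha_neq0 => //; exact: Lrel_refl.
have := alphaA e e x; rewrite ee ex => /(mulIf aex) <-.
by rewrite fscaleK ?alpha_ee.
Qed.

Lemma Re_st x : (st x \in Re) = (x \in Le).
Proof. by rewrite !inE -{1}ste Rrel_st. Qed.

Lemma Le_st x : (st x \in Le) = (x \in Re).
Proof. by rewrite -Re_st stK. Qed.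

Lemma D_st x : (st x \in D) = (x \in D).
Proof. by rewrite !inE -{1}ste (Jrel_st mulA). Qed.

Lemma star_unitG : star_lin st unitG = unitG.
Proof. by rewrite star_linZ star_lin_basis // ste. Qed.

Lemma tmul_unitG a : supported Le a -> a ** unitG = a.
Proof.
move=> La; apply: (can_inj (star_linK (R := R) stK)).
rewrite star_tmulD star_unitG unitG_tmul //.
by apply: star_lin_supported La => x; rewrite Le_st.
Qed.

(** * Coordinates on the span of [D] given by the representatives [u L] *)

Variables (Ls : {set {set S}}) (u : {set S} -> S).
Hypothesis u_Re : forall L, L \in Ls -> u L \in Re.
Hypothesis u_onto : forall x, x \in D -> exists2 L, L \in Ls & Lrel mul x (u L).
Hypothesis u_inj : forall L K, L \in Ls -> K \in Ls -> Lrel mul (u L) (u K) -> L = K.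

Local Notation r L := (be (u L)).
Local Notation l L := (be (st (u L))).

Lemma supported_r L : L \in Ls -> supported Re (r L).
Proof. by move=> LsL; apply/supported_basis/u_Re. Qed.

Lemma supported_l L : L \in Ls -> supported Le (l L).
Proof. by move=> LsL; apply/supported_basis; rewrite Le_st u_Re. Qed.

Lemma supported_rl L K a : L \in Ls -> K \in Ls -> supported G (r L ** a ** l K).
Proof.
move=> LsL LsK; apply: supported_G.
  by do 2!apply: supported_Re; apply: supported_r.
by apply: supported_Le; apply: supported_l.
Qed.

Lemma star_r L : star_lin st (r L) = l L.
Proof. exact: star_lin_basis. Qed.

Lemma star_l L : star_lin st (l L) = r L.
Proof. by rewrite star_lin_basis // stK. Qed.

(** If [x] is L-related to [u L], then [x = mul s (u L)] with [s] in [Le], and the nonvanishing of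
    [alpha] on [Le] times [Re] allows division by [alpha s (u L)]. *)
Lemma factor_r x : x \in D ->
  exists L s k, [/\ L \in Ls, s \in Le & be x = fscale k (be s ** r L)].
Proof.
move=> Dx; have [L LsL xL] := u_onto Dx.
have := u_Re LsL; rewrite inE => /andP[ue eu].
have eue := leR_idem mulA ee ue.
(* A factor [s] may be replaced by [mul s e], which lies below [e], because [mul e (u L) = u L];
   when [x = u L] the factor is [e] itself. *)
have [s ses xs] : exists2 s, leL mul s e & x = mul s (u L).
  case/andP: xL => /leLP[xu _|[s xs] _].
    by exists e; rewrite ?leL_refl ?eue.
  by exists (mul s e); rewrite ?leLM // -mulA eue.
have Ls_ : s \in Le.
  rewrite inE; apply: stableL => //; apply: leJ_trans (D_up Dx) _ => //.
  by rewrite xs leJMr.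
exists L, s, (alpha s (u L))^-1; split=> //.
rewrite tmul_basis -xs /alphaD -xs (D_up Dx) fscaleK //.
rewrite inE in Ls_; apply: alpha_neq0 => //.
by have := u_Re LsL; rewrite inE.
Qed.

Lemma factor_l x : x \in D ->
  exists L s k, [/\ L \in Ls, s \in Re & be x = fscale k (l L ** be s)].
Proof.
rewrite -D_st => /factor_r[L [s [k [LsL sLe E]]]].
exists L, (st s), k; split=> //; first by rewrite Re_st.
by rewrite -[x in LHS]stK -star_lin_basis // E star_linZ star_tmulD !star_lin_basis.
Qed.

Lemma gen_r y : (forall L, L \in Ls -> r L ** y = 0) ->
  forall a, supported D a -> a ** y = 0.
Proof.
move=> ry a Da; apply: (supported_ind (P := fun a => a ** y = 0)) Da _ _ _ _
  => [|b c hb hc|k b hb|x]; rewrite ?tmul0l ?tmulDl ?tmulZl ?hb ?hc ?addr0 ?fscale0r //.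
case/factor_r=> L [s [k [LsL _ ->]]].
by rewrite tmulZl -tmulDA ry // tmul0r fscale0r.
Qed.

Lemma gen_l y : (forall L, L \in Ls -> y ** l L = 0) ->
  forall a, supported D a -> y ** a = 0.
Proof.
move=> yl a Da; apply: (can_inj (star_linK (R := R) stK)).
rewrite star_lin0 star_tmulD; apply: gen_r => [L LsL|].
  by rewrite -star_l -star_tmulD yl // star_lin0.
by apply: star_lin_supported Da => x; rewrite D_st.
Qed.

(** In the coordinates [l J ** g ** r M] this is the diagonal matrix of [unitG], so that
    [r L ** gram ** l K] is an entry of the square of [P_D]. *)
Definition gram := \sum_(L in Ls) l L ** r L.

Lemma star_gram : star_lin st gram = gram.
Proof.
rewrite star_lin_sum; apply: eq_bigr => L _.
by rewrite star_tmulD star_r star_l.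
Qed.

(** Green's lemma: [mul (st (u L)) x] is R-related to [st (u L)], which determines [L]; left
    multiplication by [st (u L)] can be undone on [Re] because [e] is a left multiple of
    [st (u L)]. *)
Lemma mul_st_u_inj L K x y : L \in Ls -> K \in Ls -> x \in Re -> y \in Re ->
  mul (st (u L)) x = mul (st (u K)) y -> L = K /\ x = y.
Proof.
move=> LsL LsK; rewrite !inE => Rx Ry E.
have stu J z : J \in Ls -> Rrel mul z e -> Rrel mul (mul (st (u J)) z) (st (u J)).
  move=> LsJ /(Rrel_mul2l mulA (st (u J))).
  have /andP[/(leL_idem mulA ee) -> //] : Lrel mul (st (u J)) e.
  by have := Le_st (u J); rewrite u_Re // inE.
have LK : L = K.
  apply: u_inj => //; rewrite -(Rrel_st stK stM).
  by apply: Rrel_trans (stu K y LsK Ry) => //; rewrite -E Rrel_sym stu.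
split=> //; have := Le_st (u K); rewrite u_Re // inE => /andP[_ /leLP].
rewrite LK in E; case=> [eu|[t et]].
  by move: E; rewrite -eu !(leR_idem mulA ee) //; [case/andP: Ry|case/andP: Rx].
have ex z : Rrel mul z e -> z = mul t (mul (st (u K)) z).
  by case/andP=> ze _; rewrite mulA -et (leR_idem mulA ee).
by rewrite (ex x) // E -ex.
Qed.

(** By [mul_st_u_inj] the products [mul (st (u L)) x] are pairwise distinct, so the coefficient of
    the sum at such a product is [g L x] times a nonzero value of [alphaD]. *)
Lemma free_l (g : {set S} -> {ffun S -> R}) :
  (forall L, L \in Ls -> supported Re (g L)) ->
  \sum_(L in Ls) l L ** g L = 0 -> forall L, L \in Ls -> g L = 0.
Proof.
move=> gRe g0 L LsL; apply/ffunP=> x; rewrite [RHS]ffunE.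
have [Rx|/(gRe L LsL)//] := boolP (x \in Re).
have/ffunP/(_ (mul (st (u L)) x)) := g0.
rewrite sum_ffunE [RHS]ffunE (bigD1 L) //= [X in _ + X]big1 ?addr0; last first.
  move=> K /andP[LsK KL]; rewrite tmul_basisl big1 // => y /eqP E.
  have [Ry|/(gRe K LsK)->] := boolP (y \in Re); last by rewrite mul0r.
  have [/eqP] := mul_st_u_inj LsK LsL Ry Rx E.
  by rewrite (negbTE KL).
rewrite tmul_basisl (bigD1 x) //= big1 ?addr0; last first.
  move=> y /andP[/eqP E yx].
  have [Ry|/(gRe L LsL)->] := boolP (y \in Re); last by rewrite mul0r.
  have [_ /eqP] := mul_st_u_inj LsL LsL Ry Rx E.
  by rewrite (negbTE yx).
have Lu : Lrel mul (st (u L)) e by have := Le_st (u L); rewrite u_Re // inE.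
rewrite inE in Rx.
move/eqP; rewrite mulf_eq0 => /orP[/eqP//|]; rewrite /alphaD ifT.
  by rewrite (negbTE (alpha_neq0 Lu Rx)).
have /andP[_ /(leJ_trans mulA)] := Lrel_Jrel Lu; apply.
apply: leR_leJ; have /andP[_] := Rrel_mul2l mulA (st (u L)) Rx.
by rewrite (leL_idem mulA ee) //; case/andP: Lu.
Qed.

(** * Identity of the principal factor when its right annihilator is zero *)

Section Unital.
Hypothesis r_inj : forall y, supported D y ->
  (forall L, L \in Ls -> r L ** y = 0) -> y = 0.

(** The terms of [gram ** y] are [l L ** (r L ** y)]; independence of the [l L] makes every
    [r L ** y] vanish. *)
Lemma gram_inj y : supported D y -> gram ** y = 0 -> y = 0.
Proof.
move=> Dy wy; apply: r_inj => //; apply: free_l.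
  by move=> L LsL; apply/supported_Re/supported_r.
by rewrite -[RHS]wy tmul_suml; apply: eq_bigr => L _; rewrite tmulDA.
Qed.

Lemma gram_surj b : supported D b -> exists2 a, supported D a & gram ** a = b.
Proof.
(* Multiplication by [gram] on the span of [D] is completed by the identity on the other basis
   elements, which gives an injective map of the whole space. *)
move=> Db; pose f a : {ffun S -> R} := gram ** restr D a + (a - restr D a).
have Dr a : supported D (gram ** restr D a) by apply/supported_Dr/supported_restr.
have f0 a : f a = 0 -> a = 0.
  move=> fa0; have Da : supported D a.
    move=> z Dz; have /ffunP/(_ z) := fa0.
    by rewrite ffunE (Dr a z Dz) add0r !ffunE (negbTE Dz) subr0.
  move: fa0; rewrite /f restr_id // subrr addr0; exact: gram_inj.
have fD a c : f (a + c) = f a + f c.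
  by rewrite /f restrD tmulDr opprD (addrACA a c) (addrACA (gram ** restr D a)).
have fZ k a : f (fscale k a) = fscale k (f a).
  rewrite /f restrZ tmulZr !fscaleDr; congr (_ + (_ + _)).
  by apply/ffunP=> z; rewrite !ffunE mulrN.
have [a fab] := lin_inj_surj fD fZ f0 b.
exists (restr D a); first exact: supported_restr.
by rewrite -(restr_id Db) -fab /f restrD restrB_id addr0 (restr_id (Dr a)).
Qed.

(** A solution [h] of [gram ** h = gram] is a left identity by injectivity; its image under
    [star_lin st] is a right identity, hence equal to [h]. The same duality makes a solution [v] of
    [gram ** v = h] a two-sided inverse of [gram]. *)
Lemma principal_factor_unital : exists h v,
  [/\ supported D h, supported D v, gram ** v = h, v ** gram = h &
      forall y, supported D y -> h ** y = y /\ y ** h = y].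
Proof.
have Dstar a : supported D a -> supported D (star_lin st a).
  by apply: star_lin_supported => x; rewrite D_st.
have Dgram : supported D gram.
  by apply: supported_sum => L LsL; apply/supported_Dl/supported_LeD/supported_l.
have [h Dh wh] := gram_surj Dgram.
have hl y : supported D y -> h ** y = y.
  move=> Dy; apply/eqP; rewrite -subr_eq0; apply/eqP; apply: gram_inj.
    by apply: supportedB => //; apply: supported_Dr.
  by rewrite tmulBr tmulDA wh subrr.
have hr y : supported D y -> y ** star_lin st h = y.
  move=> Dy; apply: (can_inj (star_linK (R := R) stK)).
  by rewrite star_tmulD star_linK // hl //; apply: Dstar.
have hh : star_lin st h = h by rewrite -[LHS]hl ?hr //; apply: Dstar.
have [v Dv wv] := gram_surj Dh.
have vw : star_lin st v ** gram = h by rewrite -star_gram -star_tmulD wv.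
have vv : star_lin st v = v.
  rewrite -[LHS]hr ?hh; last exact: Dstar.
  by rewrite -wv tmulDA vw hl.
exists h, v; split=> //; first by rewrite -{1}vv.
by move=> y Dy; rewrite hl // -hh hr.
Qed.

End Unital.

(** The product of [u L] and [st (u K)] is below [e] for both one-sided orders, so by stability it
    lies in [G] exactly when it is above [e]: the two cases of [Pmx] are those of [alphaD]. *)
Lemma PmxE L K : L \in Ls -> K \in Ls -> Pmx mul alpha G st u L K = r L ** l K.
Proof.
move=> LsL LsK; rewrite /Pmx tmul_basis /alphaD.
have uL : leR mul (mul (u L) (st (u K))) e.
  apply: leR_trans (leRM _ _ _) _ => //.
  by have := u_Re LsL; rewrite inE => /andP[].
have uK : leL mul (mul (u L) (st (u K))) e.
  apply: leL_trans (leLM _ _ _) _ => //.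
  by have := u_Re LsK; rewrite -Le_st inE => /andP[].
have -> : (mul (u L) (st (u K)) \in G) = leJ mul e (mul (u L) (st (u K))).
  apply/idP/idP => [|eLK]; last by rewrite G_ReLe !inE stableR ?stableL.
  by rewrite G_ReLe inE => /andP[/Rrel_Jrel/andP[]].
by case: ifP => // _; apply/ffunP=> z; rewrite !ffunE mul0r.
Qed.

Lemma gram_inv_mx_invertible h v :
  supported D v -> gram ** v = h -> v ** gram = h ->
  (forall y, supported D y -> h ** y = y /\ y ** h = y) ->
  mx_invertible mul alpha (supported G) Ls (Pmx mul alpha G st u).
Proof.
move=> Dv wv vw hD.
(* Independence of the [l L] reduces this to [gram ** v ** l K = l K]. *)
have rvl L K : L \in Ls -> K \in Ls -> r L ** v ** l K = if L == K then unitG else 0.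
  move=> LsL LsK; apply/eqP; rewrite -subr_eq0; apply/eqP.
  apply: (free_l (g := fun L => r L ** v ** l K - (if L == K then unitG else 0))) LsL.
    move=> J LsJ; apply: supportedB; first exact/supported_GRe/supported_rl.
    by case: ifP => _; [exact/supported_GRe/supported_unitG|exact: supported0].
  under eq_bigr => J _ do rewrite tmulBr !tmulDA.
  rewrite sumrB -2!tmul_suml wv (proj1 (hD _ _)); last exact/supported_LeD/supported_l.
  rewrite (bigD1 K) //= eqxx tmul_unitG; last exact: supported_l.
  rewrite big1 ?addr0 ?subrr // => J /andP[_ /negbTE->]; exact: tmul0r.
(* In matrix coordinates the product of [X] and [Y] is [X P_D Y], so [gram], [v] and [v ** v] are
   [1], [P_D^-2] and [P_D^-3]; sandwiching the last between two factors [P_D] gives [P_D^-1]. *)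
pose Q L K := r L ** (v ** v) ** l K.
have GQ L K : L \in Ls -> K \in Ls -> supported G (Q L K) by apply: supported_rl.
have GP L K : L \in Ls -> K \in Ls -> supported G (Pmx mul alpha G st u L K).
  move=> LsL LsK; rewrite PmxE //; apply: supported_G.
    exact/supported_Re/supported_r.
  exact/supported_Le/supported_l.
exists Q, unitG; split=> //; first exact: supported_unitG.
  move=> a Ga; rewrite !tmulD_G //; try exact: supported_unitG.
  by rewrite unitG_tmul ?tmul_unitG //; [exact: supported_GLe|exact: supported_GRe].
move=> L K LsL LsK; rewrite -rvl //; split.
  rewrite /mxmul (eq_bigr (fun J => r L ** (l J ** r J) ** (v ** v ** l K))).
    rewrite -tmul_suml -tmul_sumr -/gram -!tmulDA; congr (_ ** _).
    by rewrite !tmulDA wv (proj1 (hD _ Dv)).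
  by move=> J LsJ; rewrite (tmulD_G (GP _ _ LsL LsJ) (GQ _ _ LsJ LsK)) PmxE // /Q !tmulDA.
rewrite /mxmul (eq_bigr (fun J => r L ** (v ** v) ** (l J ** r J) ** l K)).
  rewrite -tmul_suml -tmul_sumr -/gram -!tmulDA; congr (_ ** _).
  by rewrite !tmulDA -(tmulDA v v) vw (proj2 (hD _ Dv)).
by move=> J LsJ; rewrite (tmulD_G (GQ _ _ LsL LsJ) (GP _ _ LsJ LsK)) PmxE // /Q !tmulDA.
Qed.

(** The element [c] whose matrix is the inverse [Q] of [P_D] is an identity on the span of [D], and
    every term of [c ** y ** c] contains a factor [r L ** y ** l K]. *)
Lemma mx_invertible_sandwich_inj y :
  mx_invertible mul alpha (supported G) Ls (Pmx mul alpha G st u) ->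
  supported D y ->
  (forall L K, L \in Ls -> K \in Ls -> r L ** y ** l K = 0) -> y = 0.
Proof.
case=> Q [e1 [Ge1 e1id GQ PQ]] Dy rly.
have e1E : e1 = unitG.
  have [E _] := e1id _ supported_unitG; rewrite -{}[RHS]E.
  rewrite tmulD_G //; last exact: supported_unitG.
  by rewrite tmul_unitG //; apply: supported_GLe.
have GP L K : L \in Ls -> K \in Ls -> supported G (r L ** l K).
  move=> LsL LsK; apply: supported_G; first exact/supported_Re/supported_r.
  exact/supported_Le/supported_l.
have PQE L K : L \in Ls -> K \in Ls ->
    \sum_(J in Ls) r L ** l J ** Q J K = if L == K then unitG else 0.
  move=> LsL LsK; rewrite -e1E -(proj1 (PQ L K LsL LsK)); apply: eq_bigr => J LsJ.
  by rewrite PmxE // (tmulD_G (GP _ _ LsL LsJ) (GQ _ _ LsJ LsK)).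
have QPE L K : L \in Ls -> K \in Ls ->
    \sum_(J in Ls) Q L J ** (r J ** l K) = if L == K then unitG else 0.
  move=> LsL LsK; rewrite -e1E -(proj2 (PQ L K LsL LsK)); apply: eq_bigr => J LsJ.
  by rewrite PmxE // (tmulD_G (GQ _ _ LsL LsJ) (GP _ _ LsJ LsK)).
pose c := \sum_(J in Ls) \sum_(M in Ls) l J ** Q J M ** r M.
have rc L : L \in Ls -> r L ** c = r L.
  move=> LsL; rewrite tmul_sumr.
  under eq_bigr => J _ do [rewrite tmul_sumr; under eq_bigr => M _ do rewrite !tmulDA].
  rewrite exchange_big /=; under eq_bigr => M LsM do rewrite -tmul_suml PQE //.
  rewrite (bigD1 L) //= eqxx unitG_tmul; last exact: supported_r.
  by rewrite big1 ?addr0 // => M /andP[_]; rewrite eq_sym => /negbTE->; rewrite tmul0l.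
have cl L : L \in Ls -> c ** l L = l L.
  move=> LsL; rewrite tmul_suml.
  under eq_bigr => J LsJ.
    rewrite tmul_suml; under eq_bigr => M _ do rewrite -!tmulDA.
    rewrite -tmul_sumr QPE //; over.
  rewrite (bigD1 L) //= eqxx tmul_unitG; last exact: supported_l.
  by rewrite big1 ?addr0 // => M /andP[_ /negbTE->]; rewrite tmul0r.
have Dc : supported D c.
  apply: supported_sum => J LsJ; apply: supported_sum => M LsM.
  exact/supported_Dr/supported_ReD/supported_r.
have ac a : supported D a -> a ** c = a.
  move=> Da; apply: (supported_ind (P := fun a => a ** c = a)) Da _ _ _ _
    => [|b d hb hd|k b hb|x]; rewrite ?tmul0l ?tmulDl ?tmulZl ?hb ?hd //.
  by case/factor_r=> L [s [k [LsL _ ->]]]; rewrite tmulZl -tmulDA rc.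
have ca a : supported D a -> c ** a = a.
  move=> Da; apply: (supported_ind (P := fun a => c ** a = a)) Da _ _ _ _
    => [|b d hb hd|k b hb|x]; rewrite ?tmul0r ?tmulDr ?tmulZr ?hb ?hd //.
  by case/factor_l=> L [s [k [LsL _ ->]]]; rewrite tmulZr tmulDA cl.
have ry L : L \in Ls -> r L ** y = 0.
  move=> LsL; rewrite -(ac y Dy) tmulDA tmul_sumr big1 // => J LsJ.
  by rewrite tmul_sumr big1 // => M LsM; rewrite !tmulDA rly // !tmul0l.
rewrite -(ca y Dy) tmul_suml big1 // => J LsJ.
by rewrite tmul_suml big1 // => M LsM; rewrite -tmulDA ry // tmul0r.
Qed.

Local Notation "a ## b" := (tmul mul alpha a b) (at level 40, left associativity).

(** * Ideals spanned by down-sets of the J-order *)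

Section DownSet.
Variable T : {set S}.
Hypothesis downT : forall x z, leJ mul x z -> z \in T -> x \in T.

Lemma supported_downl a b : supported T a -> supported T (a ## b).
Proof.
move=> Ta; apply: (supported_tmul (H := setT)) Ta _ => [x z Tx _ _|z]; last by rewrite inE.
by apply: downT Tx; apply: leJMr.
Qed.

Lemma supported_downr a b : supported T b -> supported T (a ## b).
Proof.
move=> Tb; apply: (supported_tmul (G := setT)) Tb => [x z _ Tz _|z]; last by rewrite inE.
by apply: downT Tz; apply: leJMl.
Qed.

(** Both [f ## a] and [a ## f] lie in the ideal, so both equal [f ## a ## f]. *)
Lemma ideal_unit_central f a :
  supported T f -> (forall y, supported T y -> f ## y = y /\ y ## f = y) ->
  f ## a = a ## f.
Proof.
move=> Tf fid; have [_ E1] := fid _ (supported_downl a Tf).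
have [E2 _] := fid _ (supported_downr a Tf).
by rewrite -[LHS]E1 -[RHS]E2 (tmulA mulA alphaA).
Qed.

End DownSet.

(** * Adding a top class to a down-set *)

Section TopClass.
Variables (T : {set S}) (f : {ffun S -> R}).
Hypothesis downT : forall x z, leJ mul x z -> z \in T -> x \in T.
Hypothesis DT : D \subset T.
Hypothesis topD : forall x, x \in T -> leJ mul e x -> x \in D.
Hypothesis Tf : supported (T :\: D) f.
Hypothesis f_unit : forall y, supported (T :\: D) y -> f ## y = y /\ y ## f = y.

Lemma downTD x z : leJ mul x z -> z \in T :\: D -> x \in T :\: D.
Proof.
move=> xz; rewrite !in_setD => /andP[Dz Tz]; rewrite (downT xz Tz) andbT.
apply: contraNN Dz => /D_up ex; apply: topD => //; exact: leJ_trans mulA _ _ _ ex xz.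
Qed.

Lemma supportedTD b :
  supported T b -> (forall z, leJ mul e z -> b z = 0) -> supported (T :\: D) b.
Proof.
move=> Tb b0 z; rewrite in_setD negb_and negbK => /orP[/D_up/b0//|/Tb//].
Qed.

Lemma supportedTD_up b z : supported (T :\: D) b -> leJ mul e z -> b z = 0.
Proof.
move=> Tb ez; apply: Tb; rewrite in_setD negb_and negbK.
by case: (boolP (z \in T)) => [/topD -> //|]; rewrite orbT.
Qed.

Lemma supportedTD_D b : supported (T :\: D) b -> supported D b -> b = 0.
Proof.
move=> Tb Db; apply/ffunP=> z; rewrite [RHS]ffunE.
have [Dz|/Db//] := boolP (z \in D).
exact: supportedTD_up Tb (D_up Dz).
Qed.

Lemma supportedDT b : supported D b -> supported T b.
Proof. exact: supportedS. Qed.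

Lemma supportedTDT b : supported (T :\: D) b -> supported T b.
Proof. exact/supportedS/subsetDl. Qed.

Lemma restr_up b z : supported T b -> leJ mul e z -> restr D b z = b z.
Proof.
move=> Tb ez; rewrite ffunE; case: ifPn => // Dz; apply/esym/eqP.
by apply: contraNT Dz => /(supported_in Tb)/topD; apply.
Qed.

Lemma restr_tmull b a : supported T b -> restr D b ** a = b ** a.
Proof. by move=> Tb; apply: eq_tmulD => // z; apply: restr_up. Qed.

Lemma restr_tmulr b a : supported T b -> a ** restr D b = a ** b.
Proof. by move=> Tb; apply: eq_tmulD => // z; apply: restr_up. Qed.

Lemma f_central a : f ## a = a ## f.
Proof. exact: (ideal_unit_central downTD). Qed.

Lemma f_idem : f ## f = f. Proof. by case: (f_unit Tf). Qed.

Lemma sub_tmulf b : (b - b ## f) ## f = 0.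
Proof. by rewrite tmulBl -(tmulA mulA alphaA) f_idem subrr. Qed.

Lemma semisimple_r_inj : semisimple mul alpha (fun _ => True) ->
  forall y, supported D y -> (forall L, L \in Ls -> r L ** y = 0) -> y = 0.
Proof.
move=> ss y Dy ry; have aA := tmulA mulA alphaA.
have ay a : supported T a -> supported (T :\: D) (a ## y).
  move=> Ta; apply: supportedTD => [|z ez]; first exact: supported_downl.
  by rewrite tmulD_up // -restr_tmull // (gen_r ry) ?ffunE //; apply: supported_restr.
(* If [y = y ## f], then [y] is supported both on [D] and on [T :\: D], so it vanishes. *)
suff y0 : y - y ## f = 0.
  apply: supportedTD_D => //; rewrite -(subrK (y ## f) y) y0 add0r.
  exact: (supported_downr downTD).
(* For [a] and [b] in [I] the product [a ## b] falls below [D], where [f] is an identity, so it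
   equals [a ## (b ## f) = 0]. *)
pose I y := [/\ supported T y, y ## f = 0 &
                forall a, supported T a -> supported (T :\: D) (a ## y)].
apply: (ss I); last 1 first.
- split=> [||a Ta]; [|exact: sub_tmulf|].
    apply: supportedB; first exact: supportedDT.
    exact/supported_downl/supportedDT.
  rewrite tmulBr aA; apply: supportedB; first exact: ay.
  exact/(supported_downl downTD)/ay.
- split=> //.
  + split; first exact: supported0.
      exact: tmul0l.
    by move=> a _; rewrite tmul0r; apply: supported0.
  + move=> a b [Ta af Na] [Tb bf Nb]; split; first exact: supportedD.
      by rewrite tmulDl af bf addr0.
    by move=> c Tc; rewrite tmulDr; apply: supportedD; [exact: Na|exact: Nb].
  + move=> k a [Ta af Na]; split; first exact: supportedZ.
      by rewrite tmulZl af fscale0r.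
    by move=> c Tc; rewrite tmulZr; apply: supportedZ; apply: Na.
  + move=> a b _ [Tb bf Nb]; split; split.
    * exact: supported_downr.
    * by rewrite -aA bf tmul0r.
    * by move=> c Tc; rewrite aA; apply: Nb; apply: supported_downl.
    * exact: supported_downl.
    * by rewrite -aA -f_central aA bf tmul0l.
    * by move=> c Tc; rewrite aA; apply/(supported_downl downTD)/Nb.
(* In [nilpotent] the number counts the factors after the first: here products of two elements
   vanish. *)
- exists 1%N => a [|b []] //= _ [Ta af Na] Ib.
  have [Tb bf Nb] := Ib b (mem_head _ _).
  by have [_ <-] := f_unit (Nb a Ta); rewrite -aA bf tmul0r.
Qed.

Lemma extend_unit : semisimple mul alpha (fun _ => True) ->
  exists2 f', supported T f' &
    forall y, supported T y -> f' ## y = y /\ y ## f' = y.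
Proof.
move=> ss; have aA := tmulA mulA alphaA.
have [h [v [Dh _ _ _ hD]]] := principal_factor_unital (semisimple_r_inj ss).
have hTD y : supported T y ->
    supported (T :\: D) (h ## y - y) /\ supported (T :\: D) (y ## h - y).
  move=> Ty; have [hy yh] := hD _ (@supported_restr R S D y).
  split; (apply: supportedTD => [|z ez]; [apply: supportedB => //|]).
  - exact/supported_downl/supportedDT.
  - rewrite ffunE [X in _ + X]ffunE tmulD_up // -restr_tmulr // hy.
    by rewrite restr_up // subrr.
  - exact: supported_downl.
  - rewrite ffunE [X in _ + X]ffunE tmulD_up // -restr_tmull // yh.
    by rewrite restr_up // subrr.
(* Formally [1 - (1 - f)(1 - h)]: [1 - h] sends the span of [T] into that of [T :\: D], which
   [1 - f] kills. *)
exists (f + (h - h ## f)).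
  apply: supportedD; first exact: supportedTDT.
  apply: supportedB; first exact: supportedDT.
  exact/supported_downl/supportedDT.
move=> y Ty; have [hy yh] := hTD y Ty; split.
  have [E _] := f_unit hy; rewrite tmulDl tmulBl -(f_central h) -aA.
  by rewrite addrCA -opprB -tmulBr E subKr.
have [_ E] := f_unit yh; rewrite tmulDr tmulBr aA.
by rewrite addrCA -opprB -tmulBl E subKr.
Qed.

Lemma semisimple_mx_invertible : semisimple mul alpha (fun _ => True) ->
  mx_invertible mul alpha (supported G) Ls (Pmx mul alpha G st u).
Proof.
move=> ss; have [h [v [_ Dv wv vw hD]]] := principal_factor_unital (semisimple_r_inj ss).
exact: gram_inv_mx_invertible Dv wv vw hD.
Qed.

Lemma semisimple_group : semisimple mul alpha (fun _ => True) ->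
  semisimple mul alpha (supported G).
Proof.
move=> ss N [NG N0 ND NZ NM] [n Nn] x Nx; have aA := tmulA mulA alphaA.
have r_inj := semisimple_r_inj ss.
have [h [v [Dh Dv wv _ hD]]] := principal_factor_unital r_inj.
have NMl a b : supported G a -> N b -> N (a ** b).
  by move=> Ga Nb; rewrite -tmulD_G //; [case: (NM a b Ga Nb)|exact: NG].
have NMr a b : supported G a -> N b -> N (b ** a).
  by move=> Ga Nb; rewrite -tmulD_G //; [case: (NM a b Ga Nb)|exact: NG].
pose corner a := unitG ** a ** unitG.
have corner_G a : supported G (corner a).
  apply: supported_G.
    exact/supported_Re/supported_Re/supported_GRe/supported_unitG.
  exact/supported_Le/supported_GLe/supported_unitG.
(* An element [x] of [N] is lifted to [x - x ## f] in this ideal; membership is tested on the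
   corners at [unitG], and [y ## f = 0] discards what lies below [D]. *)
pose I y := [/\ supported T y, y ## f = 0 & forall a b, N (corner (a ** y ** b))].
suff xf : x - x ## f = 0.
  apply: supportedTD_D; last exact/supported_GD/NG.
  by rewrite -(subrK (x ## f) x) xf add0r; apply: (supported_downr downTD).
have Tx : supported T x by apply/supportedDT/supported_GD/NG.
apply: (ss I); last 1 first.
- split=> [||a b]; [|exact: sub_tmulf|].
    by apply: supportedB => //; apply: supported_downl.
  have -> : a ** (x - x ## f) ** b = a ** (unitG ** x ** unitG) ** b.
    rewrite unitG_tmul; last exact/supported_GRe/NG.
    rewrite tmul_unitG; last exact/supported_GLe/NG.
    congr (_ ** _); apply: eq_tmulD => // z ez.
    have xf0 := supportedTD_up (supported_downr downTD x Tf) ez.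
    by rewrite ffunE [X in _ + X]ffunE xf0 subr0.
  rewrite /corner; have -> : unitG ** (a ** (unitG ** x ** unitG) ** b) ** unitG
      = corner a ** x ** corner b by rewrite /corner !tmulDA.
  by apply: NMr => //; apply: NMl.
- split=> //.
  + split; [exact: supported0|exact: tmul0l|].
    by move=> a b; rewrite /corner !(tmul0r, tmul0l).
  + move=> a b [Ta af Na] [Tb bf Nb]; split; first exact: supportedD.
      by rewrite tmulDl af bf addr0.
    by move=> c d; rewrite /corner !(tmulDr, tmulDl); apply: ND; [exact: Na|exact: Nb].
  + move=> k a [Ta af Na]; split; first exact: supportedZ.
      by rewrite tmulZl af fscale0r.
    by move=> c d; rewrite /corner !(tmulZr _ _ k, tmulZl _ _ k); apply: NZ; exact: (Na c d).
  + move=> a b _ [Tb bf Nb]; split; split.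
    * exact: supported_downr.
    * by rewrite -aA bf tmul0r.
    * by move=> c d; rewrite tmulD_tmulr tmulDA; exact: (Nb (c ** a) d).
    * exact: supported_downl.
    * by rewrite -aA -f_central aA bf tmul0l.
    * by move=> c d; rewrite tmulD_tmulr tmulDA -(tmulDA (c ** b)); exact: (Nb c (a ** d)).
pose K j y := forall s, size s = j -> (forall b, b \in s -> N b) ->
  foldl (tmul mul alpha) y s = 0.
(* Each factor moved from [s] into [p] puts one more factor from [N] into the corners of [p], so the
   number of further factors from [N] needed to kill these corners drops by one, down to 0. *)
have fold_corner s : forall p, (forall y, y \in s -> I y) -> supported T p -> p ## f = 0 ->
    (forall a b, K (size s) (corner (a ** p ** b))) ->
    let q := foldl (tmul mul alpha) p s in
    [/\ supported T q, q ## f = 0 & forall a b, corner (a ** q ** b) = 0].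
  elim: s => [|y s IHs] p Is Tp pf Kp; first by split=> // a b; apply: (Kp a b [::]).
  have [Ty yf Ny] := Is y (mem_head _ _).
  apply: IHs => [z zs|||a b t ts Nt].
  - by apply: Is; rewrite inE zs orbT.
  - exact: supported_downl.
  - by rewrite -aA yf tmul0r.
  (* Inserting the identity [h = gram ** v] between [p] and [y] splits the corner into products of
     two corners, the second of which lies in [N]. *)
  have -> : corner (a ** (p ## y) ** b) =
      \sum_(L in Ls) corner (a ** p ** l L) ## corner (r L ** v ** y ** b).
    have -> : a ** (p ## y) ** b = a ** p ** h ** y ** b.
      rewrite tmulD_tmulr -(restr_tmull y Tp).
      have [_ {1}<-] := hD _ (@supported_restr R S D p).
      by rewrite (restr_tmull h Tp) !tmulDA.
    rewrite /corner -wv /gram !(tmul_suml, tmul_sumr); apply: eq_bigr => L LsL.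
    have lE : a ** p ** l L ** unitG = a ** p ** l L.
      by rewrite -tmulDA (tmul_unitG (supported_l LsL)).
    have rE : unitG ** (r L ** v ** y ** b) = r L ** v ** y ** b.
      by rewrite !tmulDA (unitG_tmul (supported_r LsL)).
    rewrite (tmulD_G (corner_G (a ** p ** l L)) (corner_G (r L ** v ** y ** b))).
    by rewrite /corner rE -(tmulDA unitG (a ** p ** l L)) lE !tmulDA.
  apply: (big_ind (fun y => foldl (tmul mul alpha) y t = 0)) => [|c d c0 d0|L LsL].
  - exact: foldl_tmul0.
  - by rewrite foldl_tmulD c0 d0 addr0.
  apply: (Kp a (l L) (corner (r L ** v ** y ** b) :: t)); first by rewrite /= ts.
  by move=> c; rewrite inE => /orP[/eqP->|/Nt//]; apply: Ny.
exists n => p s sn Ip Is; have [Tp pf Np] := Ip.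
have [|Tq qf q0] := fold_corner s p Is Tp pf.
  by move=> a b t ts Nt; apply: Nn; rewrite ?ts.
set q := foldl _ p s in Tq qf q0 *.
(* All corners of [q] vanish; testing with [r L] and [l M] shows that [q] has no part in [D], and
   then [q = q ## f = 0]. *)
suff Dq0 : restr D q = 0.
  have /f_unit[_ <-] : supported (T :\: D) q by
    apply: supportedTD => // z ez; rewrite -restr_up // Dq0 ffunE.
  exact: qf.
apply: r_inj => [|L LsL]; first exact: supported_restr.
have Dr : supported D (r L ** restr D q) by apply/supported_Dr/supported_restr.
have [_ <-] := hD _ Dr.
apply: gen_l => // M LsM.
rewrite (restr_tmulr _ Tq) -(unitG_tmul (supported_r LsL)).
rewrite -(tmul_unitG (supported_l LsM)) !tmulDA.
by have := q0 (r L) (l M); rewrite /corner !tmulDA.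
Qed.

End TopClass.

(** By [topy], [y] agrees above [e] with its part in [D], so each sandwich of this part by [r L] and
    [l M] agrees above [e] with an element of [I]. *)
Lemma ideal_vanish (I : {ffun S -> R} -> Prop) y :
  semisimple mul alpha (supported G) ->
  mx_invertible mul alpha (supported G) Ls (Pmx mul alpha G st u) ->
  is_ideal mul alpha (fun _ => True) I -> nilpotent mul alpha I -> I y ->
  (forall x, y x != 0 -> leJ mul e x -> x \in D) ->
  forall x, x \in D -> y x = 0.
Proof.
move=> ssG Pinv [_ I0 ID IZ IM] [n In] Iy topy x Dx.
(* Above [e], a product depends only on coefficients above [e], so [N] is an ideal of [R^alpha[G_D]]
   and inherits nilpotency from [I]. *)
pose N a := supported G a /\ exists2 b, I b & forall z, leJ mul e z -> b z = a z.
have tmulG a b : supported G a -> supported G b -> supported G (a ## b).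
  move=> Ga Gb; rewrite tmulD_G //; apply: supported_G.
    exact/supported_Re/supported_GRe.
  exact/supported_Le/supported_GLe.
have tmul_up a a' b b' : (forall z, leJ mul e z -> a z = a' z) ->
    (forall z, leJ mul e z -> b z = b' z) ->
    forall z, leJ mul e z -> (a ## b) z = (a' ## b') z.
  by move=> aa bb z ez; rewrite !tmulD_up // (eq_tmulD aa bb).
have N_eq0 a : N a -> a = 0.
  apply: ssG; first split.
  - by move=> ? [].
  - by split; [exact: supported0|exists 0].
  - move=> b c [Gb [b' Ib bb]] [Gc [c' Ic cc]]; split; first exact: supportedD.
    by exists (b' + c'); [exact: ID|move=> z ez; rewrite !ffunE bb ?cc].
  - move=> k b [Gb [b' Ib bb]]; split; first exact: supportedZ.
    by exists (fscale k b'); [exact: IZ|move=> z ez; rewrite !ffunE bb].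
  - move=> b c Gb [Gc [c' Ic cc]]; have [Il Ir] := IM b c' Logic.I Ic.
    split; (split; first exact: tmulG).
      by exists (b ## c') => //; apply: tmul_up.
    by exists (c' ## b) => //; apply: tmul_up.
  exists n => b s sn Nb Ns.
  (* A product in [N] is lifted factor by factor to a product in [I] of the same length. *)
  have fold_lift c c' : supported G c -> (forall z, leJ mul e z -> c' z = c z) ->
      supported G (foldl (tmul mul alpha) c s) /\
      exists s', [/\ size s' = size s, forall d, d \in s' -> I d &
        forall z, leJ mul e z ->
          foldl (tmul mul alpha) c' s' z = foldl (tmul mul alpha) c s z].
    elim: s {sn} Ns c c' => [|d s IHs] Ns c c' Gc cc; first by split=> //; exists [::].
    have [Gd [d' Id dd]] := Ns d (mem_head _ _).
    have [|||Gs [s' [ss' Is' E]]] := IHs _ (c ## d) (c' ## d').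
    + by move=> g gs; apply: Ns; rewrite inE gs orbT.
    + exact: tmulG.
    + exact: tmul_up.
    split=> //; exists (d' :: s'); split=> //=; first by rewrite ss'.
    by move=> g; rewrite inE => /orP[/eqP->|/Is'].
  case: Nb => Gb [b' Ib bb]; have [Gs [s' [ss' Is' E]]] := fold_lift b b' Gb bb.
  apply/ffunP=> z; rewrite [RHS]ffunE.
  have [Gz|/Gs//] := boolP (z \in G).
  rewrite -E; first by rewrite In ?ss' ?ffunE.
  by move: Gz; rewrite G_ReLe inE => /andP[/Rrel_Jrel/andP[]].
have yr z : leJ mul e z -> restr D y z = y z.
  move=> ez; rewrite ffunE; case: ifPn => // Dz; apply/esym/eqP.
  by apply: contraNT Dz => /topy; apply.
rewrite -[y x]yr; last exact: D_up.
rewrite (mx_invertible_sandwich_inj Pinv (@supported_restr R S D y)) ?ffunE // => L M LsL LsM.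
apply: N_eq0; split; first exact: supported_rl.
exists (r L ## y ## l M).
  by apply: (proj2 (IM _ _ _ _)) => //; apply: (proj1 (IM _ _ _ _)).
move=> z ez; rewrite tmulD_up // tmulD_tmull; congr (fun_of_fin _ z).
by congr (_ ** _); apply: eq_tmulD => // t et; rewrite yr.
Qed.

End PrincipalFactor.

(** * Semisimplicity *)

Section Semisimplicity.
Set Implicit Arguments. Unset Strict Implicit.
Variables (R : fieldType) (S : finType) (mul : S -> S -> S) (st : S -> S).
Variables (alpha : S -> S -> R) (one : {set S} -> S) (u : {set S} -> S).
Hypothesis mulA : associative mul.
Hypothesis stK : involutive st.
Hypothesis stM : forall x y, st (mul x y) = mul (st y) (st x).
Hypothesis alphaA : forall x y z,
  alpha x y * alpha (mul x y) z = alpha x (mul y z) * alpha y z.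
Hypothesis alpha_st : forall x y, alpha x y = alpha (st y) (st x).
Hypothesis oneP : forall D, D \in Dclasses mul ->
  [/\ one D \in D, mul (one D) (one D) = one D & st (one D) = one D].
Hypothesis alpha_neq0 : forall D x y, D \in Dclasses mul ->
  Lrel mul x (one D) -> Rrel mul y (one D) -> alpha x y != 0.
Hypothesis uP : forall D L, D \in Dclasses mul -> L \in Lclasses_in mul D ->
  u L \in L /\ Rrel mul (u L) (one D).

Local Notation "a ## b" := (tmul mul alpha a b) (at level 40, left associativity).

Lemma Dclass_one D : D \in Dclasses mul -> D = [set x | Jrel mul x (one D)].
Proof. by move=> DD; have [oneD _ _] := oneP DD; apply: Dclass_eq. Qed.

Lemma u_one D L : D \in Dclasses mul -> L \in Lclasses_in mul D ->
  u L \in [set x | Rrel mul x (one D)].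
Proof. by move=> DD /(uP DD)[_]; rewrite inE. Qed.

Lemma u_Lclass D x : D \in Dclasses mul -> x \in [set x | Jrel mul x (one D)] ->
  exists2 L, L \in Lclasses_in mul D & Lrel mul x (u L).
Proof.
move=> DD; rewrite -Dclass_one // => Dx.
have LsL : Lclass mul x \in Lclasses_in mul D by apply: imset_f.
by exists (Lclass mul x) => //; have [] := uP DD LsL; rewrite inE.
Qed.

Lemma u_Lrel_inj D L K : D \in Dclasses mul ->
  L \in Lclasses_in mul D -> K \in Lclasses_in mul D ->
  Lrel mul (u L) (u K) -> L = K.
Proof.
move=> DD LsL LsK; have [uL _] := uP DD LsL; have [uK _] := uP DD LsK.
case/imsetP: LsL uL => x _ ->; case/imsetP: LsK uK => z _ ->.
rewrite !inE => zu xu uu; apply/setP=> t; rewrite !inE.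
have xz : Lrel mul x z.
  by apply: Lrel_trans xu _ => //; apply: Lrel_trans uu _ => //; rewrite Lrel_sym.
apply/idP/idP; last exact: Lrel_trans.
by apply: Lrel_trans => //; rewrite Lrel_sym.
Qed.

(** Strong induction on the cardinal of [T]: the class of a J-maximal element is removed, and
    [extend_unit] puts it back. *)
Lemma ideal_unit (T : {set S}) : semisimple mul alpha (fun _ => True) ->
  (forall x z, leJ mul x z -> z \in T -> x \in T) ->
  exists2 f, supported T f & forall y, supported T y -> f ## y = y /\ y ## f = y.
Proof.
move=> ss; have [n] := ubnP #|T|; elim: n T => // n IHn T Tn downT.
have [->|T0] := eqVneq T set0.
  exists 0; first exact: supported0.
  move=> y y0; have -> : y = 0 by apply/ffunP=> z; rewrite y0 ?inE // ffunE.
  by rewrite tmul0l.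
have [x Tx maxx] := exists_leJ_max mulA T0.
pose D := Dclass mul x; have DD : D \in Dclasses mul by apply: imset_f.
have [oneD ee ste] := oneP DD; set e := one D in oneD ee ste.
have DE : D = [set z | Jrel mul z e] by apply: Dclass_one.
have xe : Jrel mul x e.
  have : x \in D by rewrite inE Drel_Jrel // Jrel_refl.
  by rewrite DE inE.
have DT : [set z | Jrel mul z e] \subset T.
  apply/subsetP=> z; rewrite inE => /(Jrel_trans mulA)-/(_ x).
  by rewrite Jrel_sym => /(_ xe)/andP[zx _]; apply: downT zx Tx.
have topD z : z \in T -> leJ mul e z -> z \in [set z | Jrel mul z e].
  move=> Tz ez; rewrite inE /Jrel ez andbT.
  case/andP: xe => xe ex; apply: (leJ_trans mulA) (xe); apply: maxx => //.
  exact: leJ_trans xe ez.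
have [|f Tf fid] := IHn (T :\: [set z | Jrel mul z e]) _ (downTD mulA downT topD).
  rewrite -ltnS; apply: leq_trans Tn; rewrite ltnS; apply: proper_card.
  apply/properP; split; first exact: subsetDl.
  by exists x; rewrite // in_setD inE xe.
exact: (extend_unit mulA stK stM alphaA alpha_st ee ste
  (fun x y => alpha_neq0 DD) (fun L => u_one DD) (fun x => u_Lclass DD)
  (fun L K => u_Lrel_inj DD) downT DT topD Tf fid ss).
Qed.

Lemma semisimple_twistedP :
  semisimple mul alpha (fun _ => True) <->
  (forall D, D \in Dclasses mul ->
     semisimple mul alpha (supported (Hclass mul (one D))) /\
     mx_invertible mul alpha (supported (Hclass mul (one D))) (Lclasses_in mul D)
       (Pmx mul alpha (Hclass mul (one D)) st u)).
Proof.
split=> [ss D DD|ssD I idI nilI y Iy].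
  have [oneD ee ste] := oneP DD; set e := one D in oneD ee ste *.
  (* In the principal down-set of [e] the class [D] is on top, and [ideal_unit] applies to what lies
     strictly below it. *)
  pose T := [set x | leJ mul x e].
  have downT x z : leJ mul x z -> z \in T -> x \in T.
    by rewrite !inE; apply: leJ_trans.
  have DT : [set x | Jrel mul x e] \subset T.
    by apply/subsetP=> x; rewrite !inE => /andP[].
  have topD x : x \in T -> leJ mul e x -> x \in [set x | Jrel mul x e].
    by rewrite !inE => xe ex; rewrite /Jrel xe.
  have [f Tf fid] := ideal_unit ss (downTD mulA downT topD).
  split.
    exact: (semisimple_group mulA stK stM alphaA alpha_st ee ste
      (fun x y => alpha_neq0 DD) (fun L => u_one DD) (fun x => u_Lclass DD)
      (fun L K => u_Lrel_inj DD) downT DT topD Tf fid ss).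
  exact: (semisimple_mx_invertible mulA stK stM alphaA alpha_st ee ste
    (fun x y => alpha_neq0 DD) (fun L => u_one DD) (fun x => u_Lclass DD)
    (fun L K => u_Lrel_inj DD) downT DT topD Tf fid ss).
have [y0|] := eqVneq [set x | y x != 0] set0.
  apply/ffunP=> x; rewrite [RHS]ffunE; apply/eqP/negbNE/negP => yx.
  by have := in_set0 x; rewrite -y0 inE yx.
(* At the class of a J-maximal point [x] of the support, [ideal_vanish] contradicts [y x != 0]. *)
case/(exists_leJ_max mulA) => x; rewrite inE => yx maxx.
pose D := Dclass mul x; have DD : D \in Dclasses mul by apply: imset_f.
have [oneD ee ste] := oneP DD; set e := one D in oneD ee ste.
have xe : Jrel mul x e.
  have : x \in D by rewrite inE Drel_Jrel // Jrel_refl.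
  by rewrite {1}(Dclass_one DD) inE.
have [ssG Pinv] := ssD D DD.
have topy z : y z != 0 -> leJ mul e z -> z \in [set z | Jrel mul z e].
  move=> yz ez; rewrite inE /Jrel ez andbT.
  case/andP: xe => xe ex; apply: (leJ_trans mulA) (xe); apply: maxx.
    by rewrite inE.
  exact: leJ_trans xe ez.
have := ideal_vanish mulA stK stM alphaA alpha_st ee ste
  (fun x y => alpha_neq0 DD) (fun L => u_one DD) (fun x => u_Lclass DD)
  ssG Pinv idI nilI Iy topy (x := x).
by rewrite inE => /(_ xe)/eqP; rewrite (negbTE yx).
Qed.

End Semisimplicity.

Theorem theorem16 (S : finType) (mul : S -> S -> S) (st : S -> S)
    (R : fieldType) (alpha : S -> S -> R)
    (one : {set S} -> S) (u : {set S} -> S) :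
  associative mul ->
  involutive st ->
  (forall x y, st (mul x y) = mul (st y) (st x)) ->
  (forall x y z, alpha x y * alpha (mul x y) z = alpha x (mul y z) * alpha y z) ->
  (forall x y, alpha x y = alpha (st y) (st x)) ->
  (forall D, D \in Dclasses mul ->
     [/\ one D \in D, mul (one D) (one D) = one D & st (one D) = one D]) ->
  (forall D x y, D \in Dclasses mul ->
     Lrel mul x (one D) -> Rrel mul y (one D) -> alpha x y != 0) ->
  (forall D, D \in Dclasses mul ->
     cellular mul alpha (supported (Hclass mul (one D))) (star_lin st)) ->
  (forall D L, D \in Dclasses mul -> L \in Lclasses_in mul D ->
     u L \in L /\ Rrel mul (u L) (one D)) ->
  semisimple mul alpha (fun _ => True) <->
  (forall D, D \in Dclasses mul ->
     semisimple mul alpha (supported (Hclass mul (one D))) /\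
     mx_invertible mul alpha (supported (Hclass mul (one D))) (Lclasses_in mul D)
       (Pmx mul alpha (Hclass mul (one D)) st u)).
Proof.
move=> mulA stK stM alphaA alpha_st oneP alpha_neq0 _ uP.
exact: semisimple_twistedP.
Qed.
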